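(* Let $2<\alpha<\infty$ and let $\varphi_1,\varphi_2$ be conformal mappings of the unit disc $\mathbb D$ such that $\Omega_1=\varphi_1(\mathbb D)$ and $\Omega_2=\varphi_2(\mathbb D)$ are conformal $\alpha$-regular domains. Then $\Omega_1$ and $\Omega_2$ represent a conformal $\alpha$-regular pair if and only if $$ E_{\alpha}(\varphi_1,\varphi_2)=\left(\iint_{\mathbb D}\max\left\{\frac{|\varphi_1'(z)|^{\alpha}}{|\varphi_2'(z)|^{\alpha-2}},\frac{|\varphi_2'(z)|^{\alpha}}{|\varphi_1'(z)|^{\alpha-2}}\right\}dxdy\right)^{\frac{1}{\alpha}}<\infty . $$
   Context: Conformal mappings are conformal homeomorphisms onto the indicated domain (univalent holomorphic maps). A domain $\Omega\subset\mathbb C$ is conformal $\alpha$-regular ($\alpha>2$) if there is a conformal mapping $\varphi$ of the unit disc $\mathbb D$ onto $\Omega$ with $\varphi'\in L^{\alpha}(\mathbb D)$ (this does not depend on the choice of $\varphi$). Two conformal $\alpha$-regular domains $\Omega_1,\Omega_2$ represent a conformal $\alpha$-regular pair if there exists a conformal mapping $\psi:\Omega_1\to\Omega_2$ (onto) such that $$\iint_{\Omega_1}|\psi'(z)|^{\alpha}\,dxdy<\infty\quad\text{and}\quad\iint_{\Omega_2}|(\psi^{-1})'(w)|^{\alpha}\,dudv<\infty .$$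
   Formalization: The equivalence fails for arbitrary fixed maps (e.g. (z-1)^2, (z+1)^2, alpha>=4); proved instead: E_alpha(phi1,phi2)<oo iff psi=phi2∘phi1^{-1} meets the pair conditions, and the domains are a regular pair iff E_alpha(phi1,phi2∘eta)<oo for some conformal automorphism eta of the disc. *)

(* Defs.v *)
From HB Require Import structures.
From mathcomp Require Import all_boot all_order all_algebra complex.
From mathcomp Require Import all_classical all_reals all_analysis.

Set Implicit Arguments.
Unset Strict Implicit.
Unset Printing Implicit Defensive.

Import Order.TTheory GRing.Theory Num.Theory.
Import numFieldNormedType.Exports.

Local Open Scope classical_set_scope.
Local Open Scope complex_scope.
Local Open Scope ring_scope.

(* R[i]^o, i.e. R[i] as a normed module over itself: for f : Cplx R -> Cplx R,
   [derivable f z 1] is complex differentiability at z and [derive1 f] is the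
   complex derivative. *)
Notation Cplx R := (R[i]^o) (only parsing).

Definition unit_disc (R : realType) : set (Cplx R) := [set z | `|z| < 1].
Arguments unit_disc {R}.

(* `|z| lives in R[i]; this is the same number in R. *)
Definition modulus (R : realType) (z : Cplx R) : R := complex.Re `|z|.

Definition area_integral (R : realType) (U : set (Cplx R)) (h : Cplx R -> R) :
    \bar R :=
  (\int[lebesgue_measure \x lebesgue_measure]_(p in
      [set p : measurableTypeR R * measurableTypeR R | U (p.1 +i* p.2)])
    (h (p.1 +i* p.2))%:E)%E.

Definition inverse_on (R : realType) (U : set (Cplx R))
    (f : Cplx R -> Cplx R) : Cplx R -> Cplx R :=
  'pinv_(fun=> 0) U f.

(* A conformal homeomorphism of U onto V. For univalent f on an open set U, the
   nonvanishing of f' and the continuity of the inverse are automatic. *)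
Definition conformal_map (R : realType) (U V : set (Cplx R))
    (f : Cplx R -> Cplx R) : Prop :=
  [/\ forall z, U z -> derivable f z 1 /\ derive1 f z != 0,
      set_inj U f,
      f @` U = V &
      {within V, continuous (inverse_on U f)}].

(* Membership of a complex derivative in L^alpha; measurability is automatic. *)
Definition deriv_in_L (R : realType) (alpha : R) (U : set (Cplx R))
    (f : Cplx R -> Cplx R) : Prop :=
  (area_integral U (fun z => modulus (derive1 f z) `^ alpha)%R < +oo)%E.

Definition conformal_regular (R : realType) (alpha : R)
    (Omega : set (Cplx R)) : Prop :=
  [/\ open Omega, connected Omega &
      exists2 phi : Cplx R -> Cplx R,
        conformal_map unit_disc Omega phi & deriv_in_L alpha unit_disc phi].

(* The requirement on psi in [conformal_regular_pair], for a given psi. *)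
Definition regular_pair_map (R : realType) (alpha : R)
    (Omega1 Omega2 : set (Cplx R)) (psi : Cplx R -> Cplx R) : Prop :=
  [/\ conformal_map Omega1 Omega2 psi,
      deriv_in_L alpha Omega1 psi &
      deriv_in_L alpha Omega2 (inverse_on Omega1 psi)].

Definition conformal_regular_pair (R : realType) (alpha : R)
    (Omega1 Omega2 : set (Cplx R)) : Prop :=
  [/\ conformal_regular alpha Omega1, conformal_regular alpha Omega2 &
      exists psi : Cplx R -> Cplx R, regular_pair_map alpha Omega1 Omega2 psi].

Definition E_alpha (R : realType) (alpha : R) (phi1 phi2 : Cplx R -> Cplx R) :
    \bar R :=
  (area_integral unit_disc (fun z : Cplx R =>
     let d1 := modulus (derive1 phi1 z) in
     let d2 := modulus (derive1 phi2 z) in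
     Num.max (d1 `^ alpha / d2 `^ (alpha - 2)) (d2 `^ alpha / d1 `^ (alpha - 2)))%R
   `^ alpha^-1)%E.

(* Main.v *)
(** If psi o phi1 = phi2 on the disc, then |psi' o phi1| = |phi2'| / |phi1'|, so
the change of variables w = phi1 z turns the integral of |psi'|^alpha over
Omega1 into that of |phi2'|^alpha / |phi1'|^(alpha - 2) over the disc; psi^-1
gives the other quotient, and a maximum of two nonnegative functions is
integrable iff both are.  The second equivalence is the first one for phi1 and
phi2 o eta, where eta = phi2^-1 o psi o phi1.

Only finiteness matters, so a change of variables up to a multiplicative
constant is enough, and this avoids both Goursat's theorem (continuity of f')
and the exact area formula.  If |f w - f z| <= C |w - z| whenever z is in A and
w is near z, then a small square meeting A has an image of A inside a square of
side comparable to C times its own; counting dyadic squares and using outer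
regularity gives area(f A) <= 16 C^2 area(A).  Cutting the domain along the values of
floor (ln |f'|) turns this into an inequality between integrals, and the reverse
inequality is the same one for f^-1. *)
Require Import Defs.
From mathcomp Require Import all_boot all_order all_algebra complex.
From mathcomp Require Import all_classical all_reals all_analysis measurable_realfun.
From mathcomp Require Import ring lra.

Set Implicit Arguments.
Unset Strict Implicit.
Unset Printing Implicit Defensive.

Import Order.TTheory GRing.Theory Num.Theory.
Import numFieldNormedType.Exports.

Local Open Scope classical_set_scope.
Local Open Scope complex_scope.
Local Open Scope ring_scope.

Notation plane R := (measurableTypeR R * measurableTypeR R)%type (only parsing).

(** * Complex derivatives *)

Section modulus.
Context {R : realType}.
Implicit Types (z w : Cplx R) (e : R).

Lemma normr_modulus z : `|z| = (modulus z)%:C.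
Proof. by rewrite /modulus normc_def. Qed.

Lemma modulusE z : modulus z = ComplexField.Normc.normc z.
Proof. by case: z => x y; rewrite /modulus normc_def. Qed.

Lemma modulusEsqrt (x y : R) :
  modulus (x +i* y) = Num.sqrt (x ^+ 2 + y ^+ 2).
Proof. by rewrite modulusE. Qed.

Lemma modulus_ge0 z : 0 <= modulus z.
Proof. by rewrite -ler0c -normr_modulus normr_ge0. Qed.

Lemma modulus_eq0 z : (modulus z == 0) = (z == 0).
Proof.
apply/eqP/eqP => [z0|->]; last by rewrite /modulus normr0.
by apply/eqP; rewrite -normr_eq0 normr_modulus z0.
Qed.

Lemma modulus_gt0 z : (0 < modulus z) = (z != 0).
Proof. by rewrite lt0r modulus_ge0 andbT modulus_eq0. Qed.

Lemma modulus0 : modulus (0 : Cplx R) = 0.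
Proof. by apply/eqP; rewrite modulus_eq0. Qed.

Lemma modulusM z w : modulus (z * w) = modulus z * modulus w.
Proof. by rewrite !modulusE ComplexField.Normc.normcM. Qed.

Lemma modulusV z : modulus (z^-1) = (modulus z)^-1.
Proof. by rewrite !modulusE ComplexField.Normc.normcV. Qed.

Lemma modulusD z w : modulus (z + w) <= modulus z + modulus w.
Proof. by rewrite -lecR rmorphD -!normr_modulus ler_normD. Qed.

Lemma modulusN z : modulus (- z) = modulus z.
Proof. by rewrite /modulus normrN. Qed.

Lemma modulusBC z w : modulus (z - w) = modulus (w - z).
Proof. by rewrite -modulusN opprB. Qed.

Lemma ltr_modulus z e : (`|z| < e%:C) = (modulus z < e).
Proof. by rewrite normr_modulus ltcR. Qed.

Lemma ler_modulus z e : (`|z| <= e%:C) = (modulus z <= e).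
Proof. by rewrite normr_modulus lecR. Qed.

Lemma modulus_le_ReIm (x y : R) : modulus (x +i* y) <= `|x| + `|y|.
Proof.
rewrite modulusEsqrt -[leRHS]ger0_norm ?addr_ge0// -sqrtr_sqr ler_sqrt ?sqr_ge0//.
by rewrite sqrrD !real_normK ?num_real// lerD2r lerDl mulrn_wge0// mulr_ge0.
Qed.

Lemma ler_Re_modulus z : `|complex.Re z| <= modulus z.
Proof.
case: z => x y; rewrite modulusEsqrt -sqrtr_sqr ler_sqrt ?addr_ge0 ?sqr_ge0//=.
by rewrite lerDl sqr_ge0.
Qed.

Lemma ler_Im_modulus z : `|complex.Im z| <= modulus z.
Proof.
case: z => x y; rewrite modulusEsqrt -sqrtr_sqr ler_sqrt ?addr_ge0 ?sqr_ge0//=.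
by rewrite lerDr sqr_ge0.
Qed.

Lemma gt0_complex (e : Cplx R) : 0 < e -> e = (complex.Re e)%:C /\ 0 < complex.Re e.
Proof. by case: e => x y; rewrite ltcE /= => /andP[/eqP -> ->]. Qed.

End modulus.

(** * Limits and differentiability in terms of real radii *)

Section nbhs_modulus.
Context {R : realType}.
Implicit Types (z w : Cplx R) (U V : set (Cplx R)) (f g : Cplx R -> Cplx R).

(** The radii of balls in [R[i]] are elements of [R[i]], and a positive one has zero imaginary part,
    so real radii suffice. *)
Lemma nbhs_modulusP z (P : set (Cplx R)) :
  nbhs z P <-> exists2 d : R, 0 < d & forall w, modulus (w - z) < d -> P w.
Proof.
split.
  move=> /(@nbhs_normP _ (R[i]^o))[e /= /gt0_complex[-> e0] eP]; exists (complex.Re e) => // w wz.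
  by apply: eP; rewrite /ball_ /= ltr_modulus modulusBC.
move=> [d d0 dP]; apply/(@nbhs_normP _ (R[i]^o)); exists (d%:C); first by rewrite /= ltcR.
by move=> w; rewrite /ball_ /= ltr_modulus modulusBC => /dP.
Qed.

Lemma open_modulusP U : open U <->
  forall z, U z -> exists2 d : R, 0 < d & forall w, modulus (w - z) < d -> U w.
Proof.
rewrite openE; split=> oU z /oU.
  by move=> /nbhs_modulusP.
by move=> ?; apply/nbhs_modulusP.
Qed.

Definition mcontinuous_at f z := forall e : R, 0 < e ->
  exists2 d : R, 0 < d & forall w, modulus (w - z) < d -> modulus (f w - f z) < e.

Lemma within_continuous_modulusP U f : open U ->
  {within U, continuous f} <-> (forall z, U z -> mcontinuous_at f z).
Proof.
move=> oU; rewrite continuous_open_subspace//; split.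
  move=> cf z Uz e e0.
  have := cf z (mem_set Uz).
  move=> /(@cvgrPdist_lt _ R[i]^o (Cplx R) (nbhs z) _ f)/(_ e%:C).
  rewrite ltcR => /(_ e0)/nbhs_modulusP[d d0 dP]; exists d => // w /dP /=.
  by rewrite ltr_modulus modulusBC.
move=> cf z; rewrite inE => /cf {}cf; 
apply/(@cvgrPdist_lt _ R[i]^o (Cplx R) (nbhs z) _ f) => e /gt0_complex[eE e0].
apply/nbhs_modulusP; have [d d0 dP] := cf _ e0; exists d => // w /dP /=.
by rewrite eE ltr_modulus modulusBC.
Qed.

(** Differentiability without division: the bound is non-strict, so it also holds at [w = z] and
    estimates for compositions and inverses need no case distinction. *)
Definition has_cderiv f z c := forall e : R, 0 < e ->
  exists2 d : R, 0 < d & forall w, modulus (w - z) < d ->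
    modulus (f w - f z - c * (w - z)) <= e * modulus (w - z).

Lemma has_cderivP f z c : has_cderiv f z c <->
  (fun h : Cplx R => h^-1 *: (f (h + z) - f z)) @ 0^' --> (c : Cplx R).
Proof.
split.
  move=> fc; apply/cvgrPdist_le => e /gt0_complex[eE e0].
  have [d d0 dP] := fc _ e0.
  rewrite near_withinE; apply/nbhs_modulusP; exists d => // h; rewrite subr0 => hd h0.
  rewrite eE ler_modulus; have := dP (h + z); rewrite addrK => /(_ hd).
  rewrite -ler_pdivrMr ?modulus_gt0// -modulusV -modulusM.
  by rewrite mulrBl (mulfK h0) modulusBC [_ *: _]mulrC.
move=> /cvgrPdist_le fc e e0.
have := fc e%:C; rewrite ltcR => /(_ e0).
rewrite near_withinE => /nbhs_modulusP[d d0 dP]; exists d => // w wz.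
have [->|wz0] := eqVneq w z; first by rewrite !subrr mulr0 subr0 modulus0 mulr0.
have := dP (w - z); rewrite subr0 subr_eq0 => /(_ wz wz0); rewrite subrK ler_modulus.
have wz1 : w - z != 0 by rewrite subr_eq0.
rewrite -ler_pdivrMr ?modulus_gt0// -modulusV -modulusM.
by rewrite mulrBl (mulfK wz1) modulusBC [_ *: _]mulrC.
Qed.

Lemma derivable_has_cderiv f z :
  derivable f z 1 -> has_cderiv f z (derive1 f z).
Proof.
move=> df; apply/has_cderivP; move: df; rewrite /derivable /derive1.
rewrite [X in cvg (X @ _) -> _](_ : _ = fun h : Cplx R => h^-1 *: (f (h + z) - f z)) //.
by apply/funext => h /=; rewrite /GRing.scale /= mulr1.
Qed.

Lemma has_cderiv_derivable f z c :
  has_cderiv f z c -> derivable f z 1 /\ derive1 f z = c.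
Proof.
move=> /has_cderivP fc; split; last by apply/cvg_lim.
rewrite /derivable; apply/cvg_ex; exists c; move: fc.
rewrite [X in X @ _ --> _ -> _](_ : _ =
  fun h : Cplx R => h^-1 *: ((f \o shift z) (h *: 1) - f z)) //.
by apply/funext => h /=; rewrite /GRing.scale /= mulr1.
Qed.

Lemma has_cderiv_continuous f z c : has_cderiv f z c -> mcontinuous_at f z.
Proof.
move=> fc e e0; have [d d0 dP] := fc 1 ltr01.
have M0 : 0 < 1 + modulus c by rewrite ltr_pwDl// modulus_ge0.
exists (Num.min d (e / (1 + modulus c))); first by rewrite lt_min d0 divr_gt0.
move=> w; rewrite lt_min ltr_pdivlMr// => /andP[/dP wd we].
rewrite (le_lt_trans _ we)//.
rewrite -[f w - f z](subrK (c * (w - z))) (le_trans (modulusD _ _))//.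
by rewrite modulusM [leRHS]mulrC mulrDl lerD// mul1r.
Qed.

Lemma has_cderiv_comp f g z c d : has_cderiv f z c -> has_cderiv g (f z) d ->
  has_cderiv (g \o f) z (d * c).
Proof.
move=> fc gd e e0.
(* The error of [g] is paid on an increment of size at most (1 + |c|) |w - z|, and the error of [f]
   gets multiplied by |d|. *)
have [r0 r0P] : exists2 e1 : R, 0 < e1 & e1 * (1 + modulus c) + modulus d * e1 <= e.
  have M0 : 0 < 1 + modulus c + modulus d.
    by rewrite -addrA ltr_pwDl// addr_ge0// modulus_ge0.
  exists (e / (1 + modulus c + modulus d)); first by rewrite divr_gt0.
  by rewrite [modulus d * _]mulrC -mulrDr divfK// gt_eqF.
move: r0 r0P => e1 e10 e1e.
have [d1 d10 d1P] := gd _ e10.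
have [d2 d20 d2P] := has_cderiv_continuous fc d10.
have [d3 d30 d3P] := fc _ e10.
have [d4 d40 d4P] := fc _ ltr01.
exists (Num.min d2 (Num.min d3 d4)); first by rewrite !lt_min d20 d30.
move=> w; rewrite !lt_min => /and3P[/d2P/d1P w1 /d3P w3 /d4P w4] /=.
have fw : modulus (f w - f z) <= (1 + modulus c) * modulus (w - z).
  rewrite -[f w - f z](subrK (c * (w - z))) (le_trans (modulusD _ _))//.
  by rewrite modulusM mulrDl lerD// mul1r.
have -> : g (f w) - g (f z) - d * c * (w - z) =
  (g (f w) - g (f z) - d * (f w - f z)) + d * (f w - f z - c * (w - z)) by ring.
rewrite (le_trans (modulusD _ _))// modulusM.
rewrite (le_trans _ (ler_wpM2r (modulus_ge0 _) e1e))// mulrDl lerD//.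
  by rewrite (le_trans w1)// -mulrA ler_wpM2l// ltW.
by rewrite -mulrA ler_wpM2l// modulus_ge0.
Qed.

(** Since [f (g y) = y] near [w], differentiability of [f] bounds |y - w - c (g y - g w)| by a small
    multiple of |g y - g w|; continuity of [g] brings [g y] into its range. Division by [c] gives
    the expansion of [g], once |g y - g w| is controlled by |y - w|. *)
Lemma has_cderiv_inverse f g w c : c != 0 -> has_cderiv f (g w) c ->
  mcontinuous_at g w -> (\forall y \near w, f (g y) = y) ->
  has_cderiv g w c^-1.
Proof.
move=> c0 fc gw /nbhs_modulusP[r r0 rP] e e0.
have mc : 0 < modulus c by rewrite modulus_gt0.
(* The first bound yields |c|/2 |g y - g w| <= |y - w|. With the second, the error divided by |c| is
   at most e |c|/2 |g y - g w|, hence at most e |y - w|. *)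
pose e1 := Num.min (modulus c / 2) (e * modulus c ^+ 2 / 2).
have e10 : 0 < e1 by rewrite lt_min !divr_gt0// mulr_gt0// exprn_gt0.
have [d1 d10 d1P] := fc _ e10.
have [d2 d20 d2P] := gw _ d10.
exists (Num.min r d2); first by rewrite lt_min r0.
move=> y; rewrite lt_min => /andP[yr /d2P/d1P].
rewrite !rP//; last by rewrite subrr modulus0.
move=> H.
have H1 : modulus c / 2 * modulus (g y - g w) <= modulus (y - w).
  have : modulus (c * (g y - g w)) <= modulus (y - w - c * (g y - g w)) + modulus (y - w).
    have := modulusD (c * (g y - g w) - (y - w)) (y - w).
    by rewrite subrK [modulus (_ - (y - w))]modulusBC.
  rewrite modulusM => H2.
  have H3 : e1 * modulus (g y - g w) <= modulus c / 2 * modulus (g y - g w).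
    by rewrite ler_wpM2r ?modulus_ge0// ge_min lexx.
  by lra.
have -> : g y - g w - c^-1 * (y - w) = - (c^-1 * (y - w - c * (g y - g w))).
  by field.
rewrite modulusN modulusM modulusV mulrC ler_pdivrMr// (le_trans H)//.
rewrite (@le_trans _ _ (e * modulus c ^+ 2 / 2 * modulus (g y - g w)))//.
  by rewrite ler_wpM2r ?modulus_ge0// ge_min lexx orbT.
have -> : e * modulus c ^+ 2 / 2 * modulus (g y - g w) =
  e * modulus c * (modulus c / 2 * modulus (g y - g w)) by field.
rewrite [leRHS]mulrAC ler_wpM2l//.
by rewrite mulr_ge0 ?modulus_ge0// ltW.
Qed.

End nbhs_modulus.

(** * Conformal maps *)

Section conformal.
Context {R : realType}.
Implicit Types (z w : Cplx R) (U V W : set (Cplx R)) (f g : Cplx R -> Cplx R).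

Lemma inverse_onK U f z : set_inj U f -> U z -> inverse_on U f (f z) = z.
Proof. by move=> fU Uz; exact: (pinvKV (fun=> 0) fU (mem_set Uz)). Qed.

Lemma inverse_on_image U f w : (f @` U) w ->
  U (inverse_on U f w) /\ f (inverse_on U f w) = w.
Proof.
move=> Uw; split.
  apply: (@surjpinv_image_sub _ _ (fun=> 0) U (f @` U) f) => //.
  by exists w.
exact: (@pinvK _ _ (fun=> 0) U f _ (mem_set Uw)).
Qed.

Lemma eq_has_cderiv f g z c : (\forall w \near z, f w = g w) ->
  has_cderiv f z c -> has_cderiv g z c.
Proof.
move=> /nbhs_modulusP[r r0 fg] fc e /fc[d d0 dP].
exists (Num.min r d); first by rewrite lt_min r0.
move=> w; rewrite lt_min => /andP[wr /dP]; rewrite !fg// subrr modulus0//.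
Qed.

Lemma eq_mcontinuous_at f g z : (\forall w \near z, f w = g w) ->
  mcontinuous_at f z -> mcontinuous_at g z.
Proof.
move=> /nbhs_modulusP[r r0 fg] fc e /fc[d d0 dP].
exists (Num.min r d); first by rewrite lt_min r0.
move=> w; rewrite lt_min => /andP[wr /dP]; rewrite !fg// subrr modulus0//.
Qed.

Lemma conformal_has_cderiv U V f z : conformal_map U V f -> U z ->
  has_cderiv f z (derive1 f z).
Proof. by move=> [df _ _ _] /df[] /derivable_has_cderiv. Qed.

Lemma conformal_inverse_continuous U V f w : open V -> conformal_map U V f ->
  V w -> mcontinuous_at (inverse_on U f) w.
Proof. by move=> oV [_ _ _ /within_continuous_modulusP]; apply. Qed.

Lemma conformal_mapI U V f g : open U -> open V ->
  (forall z, U z -> exists2 c, c != 0 & has_cderiv f z c) ->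
  (forall z, U z -> V (f z) /\ g (f z) = z) ->
  (forall w, V w -> U (g w) /\ f (g w) = w) ->
  (forall w, V w -> mcontinuous_at g w) ->
  conformal_map U V f.
Proof.
move=> oU oV df fK gK cg.
have fI : set_inj U f.
  by move=> x y; rewrite !inE => /fK[_ {2}<-] /fK[_ {2}<-] ->.
have fUV : f @` U = V.
  apply/seteqP; split=> [_ [z /fK[? _] <-]//|w /gK[? fgw]].
  by exists (g w).
have gE : {in V, inverse_on U f =1 g}.
  move=> w; rewrite inE => /gK[Ug fgw].
  by rewrite -{1}fgw inverse_onK.
split => //.
  by move=> z /df[c c0 /has_cderiv_derivable[? ->]].
apply/within_continuous_modulusP => // w Vw.
apply: eq_mcontinuous_at (cg _ Vw).
have : nbhs w V by move: oV; rewrite openE; apply.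
by apply: filterS => y Vy; rewrite gE ?inE.
Qed.

Section conformal_map.
Variables (U V : set (Cplx R)) (f : Cplx R -> Cplx R).
Hypotheses (oU : open U) (oV : open V) (Uf : conformal_map U V f).

Lemma conformal_image z : U z -> V (f z).
Proof. by have [_ _ <- _] := Uf; exists z. Qed.

Lemma conformal_inverseK z : U z -> inverse_on U f (f z) = z.
Proof. by have [_ ? _ _] := Uf; apply: inverse_onK. Qed.

Lemma conformal_inverse_image w : V w -> U (inverse_on U f w).
Proof. by have [_ _ <- _] := Uf; move=> /inverse_on_image[]. Qed.

Lemma conformal_inverseKV w : V w -> f (inverse_on U f w) = w.
Proof. by have [_ _ <- _] := Uf; move=> /inverse_on_image[]. Qed.

Lemma conformal_inverse_has_cderiv w : V w ->
  has_cderiv (inverse_on U f) w (derive1 f (inverse_on U f w))^-1.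
Proof.
move=> Vw; have Ug := conformal_inverse_image Vw.
have [df _ _ _] := Uf; have [_ f0] := df _ Ug.
apply: has_cderiv_inverse f0 (conformal_has_cderiv Uf Ug) _ _.
  exact: conformal_inverse_continuous Uf Vw.
have : nbhs w V by move: oV; rewrite openE; apply.
by apply: filterS => y /conformal_inverseKV.
Qed.

Lemma conformal_inverse_derive1 w : V w ->
  derive1 (inverse_on U f) w = (derive1 f (inverse_on U f w))^-1.
Proof. by move=> /conformal_inverse_has_cderiv/has_cderiv_derivable[]. Qed.

Lemma conformal_inverse : conformal_map V U (inverse_on U f).
Proof.
apply: (conformal_mapI (g := f) oV oU).
- move=> w Vw; exists (derive1 f (inverse_on U f w))^-1.
    rewrite invr_neq0//; have [df _ _ _] := Uf.
    by have [] := df _ (conformal_inverse_image Vw).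
  exact: conformal_inverse_has_cderiv.
- by move=> w Vw; split; [exact: conformal_inverse_image|exact: conformal_inverseKV].
- by move=> z Uz; split; [exact: conformal_image|exact: conformal_inverseK].
- by move=> z Uz; exact: has_cderiv_continuous (conformal_has_cderiv Uf Uz).
Qed.

(** Conformality and the derivative are local, so on an open set only the values there matter. This
    allows [psi] to be prescribed only through its values on the domain. *)
Lemma eq_conformal_map f' : {in U, f =1 f'} ->
  conformal_map U V f' /\ {in U, derive1 f' =1 derive1 f}.
Proof.
move=> ff'.
have df' z : U z -> has_cderiv f' z (derive1 f z).
  move=> Uz; apply: eq_has_cderiv (conformal_has_cderiv Uf Uz).
  have : nbhs z U by move: oU; rewrite openE; apply.
  by apply: filterS => y Uy; rewrite ff' ?inE.
split; last by move=> z; rewrite inE => /df'/has_cderiv_derivable[].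
apply: (conformal_mapI (g := inverse_on U f) oU oV).
- move=> z Uz; exists (derive1 f z); last exact: df'.
  by have [/(_ _ Uz)[_ ?]] := Uf.
- move=> z Uz; rewrite -ff' ?inE//.
  by split; [exact: conformal_image|exact: conformal_inverseK].
- move=> w Vw; rewrite -ff' ?inE//; last exact: conformal_inverse_image.
  by split; [exact: conformal_inverse_image|exact: conformal_inverseKV].
- by move=> w; apply: conformal_inverse_continuous.
Qed.

End conformal_map.

Section composition.
Variables (U V W : set (Cplx R)) (f g : Cplx R -> Cplx R).
Hypotheses (oU : open U) (oV : open V) (oW : open W).
Hypotheses (Uf : conformal_map U V f) (Vg : conformal_map V W g).

Lemma conformal_comp_has_cderiv z : U z ->
  has_cderiv (g \o f) z (derive1 g (f z) * derive1 f z).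
Proof.
move=> Uz; apply: has_cderiv_comp (conformal_has_cderiv Uf Uz) _.
by apply: conformal_has_cderiv Vg _; exact: conformal_image Uf _ Uz.
Qed.

Lemma conformal_comp_derive1 z : U z ->
  derive1 (g \o f) z = derive1 g (f z) * derive1 f z.
Proof. by move=> /conformal_comp_has_cderiv/has_cderiv_derivable[]. Qed.

Lemma conformal_comp : conformal_map U W (g \o f).
Proof.
apply: (conformal_mapI (g := inverse_on U f \o inverse_on V g) oU oW).
- move=> z Uz; exists (derive1 g (f z) * derive1 f z).
    have [df _ _ _] := Uf; have [dg _ _ _] := Vg.
    rewrite mulf_neq0//; last by have [] := df _ Uz.
    by have [] := dg _ (conformal_image Uf Uz).
  exact: conformal_comp_has_cderiv.
- move=> z Uz /=; split; first exact/(conformal_image Vg)/(conformal_image Uf).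
  rewrite (conformal_inverseK Vg) ?(conformal_inverseK Uf)//.
  exact: conformal_image Uf _ Uz.
- move=> w Ww /=; have Vw := conformal_inverse_image Vg Ww.
  split; first exact: conformal_inverse_image Uf _ Vw.
  by rewrite (conformal_inverseKV Uf)// (conformal_inverseKV Vg).
- move=> w Ww; have Vw := conformal_inverse_image Vg Ww.
  apply: has_cderiv_continuous; apply: has_cderiv_comp.
    exact: conformal_inverse_has_cderiv Vg _ Ww.
  exact: conformal_inverse_has_cderiv Uf _ Vw.
Qed.

End composition.

End conformal.

(** * Measures on the plane *)

Section dyadic.
Context {R : realType}.
Implicit Types (p q : plane R) (O A : set (plane R)) (i : int * int).

Definition sqnear (r : R) p q := `|p.1 - q.1| < r /\ `|p.2 - q.2| < r.

(* Openness stated with squares: the sigma-algebra of [plane R] is a product of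
   Borel sigma-algebras and is not tied to a topology. *)
Definition sq_open O :=
  forall p, O p -> exists2 r : R, 0 < r & forall q, sqnear r p q -> O q.

(** Squares of side [2 ^- k], half-open so that those of one generation [k] partition the plane. *)
Definition pcell (k : nat) i : set (plane R) :=
  [set p | Num.floor (2 ^+ k * p.1) = i.1 /\ Num.floor (2 ^+ k * p.2) = i.2].

Let cell1 (k : nat) (j : int) : set R :=
  [set` `[(j%:~R / 2 ^+ k : R), ((j + 1)%:~R / 2 ^+ k : R)[ ].

Let pcellE k i : pcell k i = cell1 k i.1 `*` cell1 k i.2.
Proof.
have H (x : R) j : Num.floor (2 ^+ k * x) = j <-> cell1 k j x.
  rewrite /cell1/= in_itv/= ler_pdivrMr ?exprn_gt0// ltr_pdivlMr ?exprn_gt0//.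
  by rewrite -floor_eq mulrC; split => /eqP.
by apply/seteqP; split=> p [/H ? /H ?].
Qed.

Lemma measurable_pcell k i : measurable (pcell k i).
Proof. by rewrite pcellE; apply: measurableX; exact: measurable_itv. Qed.

Lemma lebesgue_pcell k i :
  (lebesgue_measure \x lebesgue_measure)%E (pcell k i) = ((2 ^- k) ^+ 2)%:E.
Proof.
rewrite pcellE product_measure1E; [|exact: measurable_itv|exact: measurable_itv].
have H j : lebesgue_measure (cell1 k j) = (2 ^- k : R)%:E.
  rewrite /cell1 lebesgue_measure_itv/= lte_fin ltr_pM2r ?invr_gt0 ?exprn_gt0//.
  rewrite ltr_int ltrDl ltr01 -EFinB -mulrBl -intrB.
  by rewrite addrAC subrr add0r mul1r.
rewrite expr2 EFinM; congr (_ * _)%E; exact: H.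
Qed.

Lemma pcell_dist k i p q : pcell k i p -> pcell k i q -> sqnear (2 ^- k) p q.
Proof.
have H (x y : R) : Num.floor (2 ^+ k * x) = Num.floor (2 ^+ k * y) -> `|x - y| < 2 ^- k.
  move=> xy; have k0 : 0 < 2 ^+ k :> R by rewrite exprn_gt0.
  rewrite -[_^-1]mul1r ltr_pdivlMr// -(gtr0_norm k0) -normrM mulrC mulrBr.
  have := ge_floor (2 ^+ k * x); have := ge_floor (2 ^+ k * y).
  have := lt_succ_floor (2 ^+ k * x); have := lt_succ_floor (2 ^+ k * y).
  rewrite xy ltr_norml.
  set a := _ * x; set b := _ * y => *; apply/andP; split; lra.
by move=> [p1 p2] [q1 q2]; split; apply: H; rewrite ?p1 ?p2 ?q1 ?q2.
Qed.

Definition inner_cells k O : set (plane R) :=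
  \bigcup_(i in [set i | pcell k i `<=` O]) pcell k i.

Lemma inner_cells_sub k O : inner_cells k O `<=` O.
Proof. by move=> p [i iO /iO]. Qed.

(** A square of generation [k.+1] lies in a single square of generation [k], because the floor of
    [2 ^+ k.+1 * x] determines that of [2 ^+ k * x]. *)
Lemma inner_cells_nondecreasing O : nondecreasing_seq (inner_cells ^~ O).
Proof.
apply/nondecreasing_seqP => k; apply/subsetPset => p [i iO [p1 p2]].
exists (Num.floor (2 ^+ k.+1 * p.1), Num.floor (2 ^+ k.+1 * p.2)) => //= q [/= q1 q2].
have H (x y : R) (j : int) : Num.floor (2 ^+ k.+1 * y) = Num.floor (2 ^+ k.+1 * x) ->
    Num.floor (2 ^+ k * x) = j -> Num.floor (2 ^+ k * y) = j.
  move=> xy /eqP; rewrite floor_eq => /andP[x1 x2]; apply/eqP; rewrite floor_eq.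
  have E (z : R) : 2 ^+ k.+1 * z = (2 ^+ k * z) * 2 by rewrite exprS; ring.
  have x1' : ((2 * j)%:~R <= 2 ^+ k.+1 * x) by rewrite E intrM mulrC ler_pM2r.
  have x2' : (2 ^+ k.+1 * x < (2 * (j + 1))%:~R) by rewrite E intrM mulrC ltr_pM2l.
  have : ((2 * j)%:~R <= 2 ^+ k.+1 * y) by rewrite -floor_ge_int xy floor_ge_int.
  have : (2 ^+ k.+1 * y < (2 * (j + 1))%:~R) by rewrite -floor_lt_int xy floor_lt_int.
  by rewrite E !intrM ![2%:~R * _]mulrC ltr_pM2r// ler_pM2r// => -> ->.
by apply: iO; split; [exact: H p1|exact: H p2].
Qed.

Lemma sq_open_inner_cells O : sq_open O -> O = \bigcup_k inner_cells k O.
Proof.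
move=> oO; apply/seteqP; split=> [p Op|p [k _]]; last exact: inner_cells_sub.
have [r r0 rO] := oO _ Op.
(* Here [r^-1 < k < 2 ^+ k], so the square of generation [k] containing [p] has side below [r] and
   stays in [O]. *)
pose k := Num.bound r^-1; exists k => //.
have kr : (2 ^- k : R) < r.
  rewrite invf_plt ?posrE ?exprn_gt0// (lt_le_trans (archi_boundP _))//.
    by rewrite invr_ge0 ltW.
  by rewrite -natrX ler_nat ltnW// ltn_expl.
exists (Num.floor (2 ^+ k * p.1), Num.floor (2 ^+ k * p.2)) => // q pq.
have [] : sqnear (2 ^- k) p q by exact: pcell_dist pq.
by move=> ? ?; apply: rO; split; exact: lt_trans kr.
Qed.

(** The inner squares as a disjoint sequence, the form that countable additivity requires; indices
    coding no square inside [O] give the empty set. *)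
Let cell_seq k O (n : nat) : set (plane R) :=
  if pickle_inv n is Some i then
    if pselect (pcell k i `<=` O) then pcell k i else set0
  else set0.

Let inner_cellsE k O : inner_cells k O = \bigcup_n cell_seq k O n.
Proof.
apply/seteqP; split=> p.
  move=> [i iO pi]; exists (pickle i); first exact: Logic.I.
  by rewrite /cell_seq pickleK_inv; case: pselect.
move=> [n _]; rewrite /cell_seq; case: pickle_inv => // i; case: pselect => // iO pi.
by exists i.
Qed.

Let trivIset_cell_seq k O : trivIset setT (cell_seq k O).
Proof.
apply/trivIsetP => m n _ _; rewrite /cell_seq.
have := @pickle_invK (int * int)%type m; have := @pickle_invK (int * int)%type n.
case: pickle_inv => [i|]/=; case: pickle_inv => [j|]/=; rewrite ?set0I ?setI0//.
case: pselect => iO; case: pselect => jO; rewrite ?set0I ?setI0// => <- <- ij.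
apply/seteqP; split => // p [[p1 p2] [q1 q2]]; have E : i = j.
  by case: (j) p1 p2 => ? ? /= <- <-; case: (i) q1 q2 => ? ? /= <- <-.
by rewrite E eqxx in ij.
Qed.

Let measurable_cell_seq k O n : measurable (cell_seq k O n).
Proof.
rewrite /cell_seq; case: pickle_inv => [i|]; last exact: measurable0.
by case: pselect => ?; [exact: measurable_pcell|exact: measurable0].
Qed.

Lemma measurable_inner_cells k O : measurable (inner_cells k O).
Proof. by rewrite inner_cellsE; exact: bigcupT_measurable. Qed.

Lemma sq_open_measurable O : sq_open O -> measurable O.
Proof.
move=> /sq_open_inner_cells ->; apply: bigcupT_measurable => k.
exact: measurable_inner_cells.
Qed.

(** An open set is the increasing union of its inner cells, each stage being a countable disjoint
    union of squares. The comparison passes to the sums, then to the limit in [k], where only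
    generations from [k0] on count. *)
Lemma sq_open_le_measure (mu nu : {measure set (plane R) -> \bar R}) k0 :
  (forall k i, (k0 <= k)%N -> (mu (pcell k i) <= nu (pcell k i))%E) ->
  forall O, sq_open O -> (mu O <= nu O)%E.
Proof.
move=> munu O oO.
have OE := sq_open_inner_cells oO.
have cO : mu \o inner_cells ^~ O @ \oo --> mu O.
  rewrite {2}OE; apply: nondecreasing_cvg_mu.
  - by move=> k; exact: measurable_inner_cells.
  - by rewrite -OE; exact: sq_open_measurable.
  - exact: inner_cells_nondecreasing.
rewrite -(cvg_lim _ cO)//; apply: lime_le; first by apply/cvg_ex; exists (mu O).
exists k0 => // k /= k0k.
apply: (@le_trans _ _ (nu (inner_cells k O))); last first.
  apply: le_measure; rewrite ?inE.
  - exact: measurable_inner_cells.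
  - exact: sq_open_measurable.
  - exact: inner_cells_sub.
rewrite inner_cellsE !measure_semi_bigcup//; try exact: bigcupT_measurable.
apply: lee_nneseries => [n _ _|n _]; first exact: measure_ge0.
rewrite /cell_seq; case: pickle_inv => [i|]; last by rewrite !measure0.
by case: pselect => ?; [exact: munu|rewrite !measure0].
Qed.

End dyadic.

Section sq_open_theory.
Context {R : realType}.
Implicit Types (p q : plane R) (O A : set (plane R)).

Lemma sq_open_bigcup (I : Type) (D : set I) (O : I -> set (plane R)) :
  (forall i, D i -> sq_open (O i)) -> sq_open (\bigcup_(i in D) O i).
Proof.
move=> oO p [i Di /(oO _ Di)[r r0 rO]]; exists r => // q /rO ?.
by exists i.
Qed.

Lemma sq_openI O1 O2 : sq_open O1 -> sq_open O2 -> sq_open (O1 `&` O2).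
Proof.
move=> o1 o2 p [/o1[r1 r10 H1] /o2[r2 r20 H2]].
exists (Num.min r1 r2); first by rewrite lt_min r10.
by move=> q []; rewrite !lt_min => /andP[? ?] /andP[? ?]; split; [apply: H1|apply: H2].
Qed.

Lemma sq_open_bigcapn (O : nat -> set (plane R)) n :
  (forall i, sq_open (O i)) -> sq_open (\big[setI/setT]_(i < n) O i).
Proof.
by move=> oO; elim/big_ind : _ => //; [move=> p _; exists 1|exact: sq_openI].
Qed.

Lemma sq_open_sqnear (r : R) A : sq_open [set p | exists2 q, A q & sqnear r p q].
Proof.
move=> p [q Aq [p1 p2]].
exists (Num.min (r - `|p.1 - q.1|) (r - `|p.2 - q.2|)).
  by rewrite lt_min !subr_gt0 p1.
move=> s []; rewrite !lt_min => /andP[s1 _] /andP[_ s2].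
exists q => //; split.
  by rewrite (le_lt_trans (ler_distD p.1 _ _))// distrC -ltrBrDr.
by rewrite (le_lt_trans (ler_distD p.2 _ _))// distrC -ltrBrDr.
Qed.

End sq_open_theory.

(** * Outer regularity of finite measures *)

Section regularity.
Context {R : realType} (nu : {measure set (plane R) -> \bar R}).
Hypothesis nufin : (nu setT < +oo)%E.
Implicit Types (p q : plane R) (O A : set (plane R)).

(* Approximating both A and its complement from outside makes the property
   visibly stable under complement. *)
Let regular A := forall e : R, 0 < e -> exists O O' : set (plane R),
  [/\ sq_open O, sq_open O', A `<=` O, ~` A `<=` O' & (nu (O `&` O') <= e%:E)%E].

Let nu_fin A : measurable A -> (nu A < +oo)%E.
Proof. by move=> mA; rewrite (le_lt_trans _ nufin)// le_measure ?inE. Qed.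

(** Continuity from above, by finiteness of [nu]. It replaces an infinite intersection, in general
    not open, by a finite stage. *)
Let nu_vanish (F : nat -> set (plane R)) (e : R) : 0 < e ->
  (forall n, measurable (F n)) -> nonincreasing_seq F ->
  (nu (\bigcap_n F n) < e%:E)%E -> exists n, (nu (F n) <= e%:E)%E.
Proof.
move=> e0 mF dF Fe.
have mI : measurable (\bigcap_n F n) by exact: bigcapT_measurable.
have := nonincreasing_cvg_mu (nu_fin (mF 0%N)) mF mI dF.
have : nu (\bigcap_n F n) \is a fin_num by rewrite ge0_fin_numE ?nu_fin.
move=> /fineK I1 I2.
have : \forall n \near \oo, (nu (F n) < e%:E)%E.
  move: I2; rewrite -I1 => /fine_cvgP[F1 /cvgr_lt].
  move=> /(_ e); rewrite -lte_fin I1 => /(_ Fe) F2.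
  near=> n; rewrite -[X in (X < _)%E]fineK; last by near: n.
  by rewrite lte_fin; near: n.
by move=> [n _ /(_ n (leqnn n)) /ltW]; exists n.
Unshelve. all: by end_near. Qed.

(** The complement of [O] is covered by its open neighbourhoods of width 1/(n+1). Their traces on
    [O] decrease to the empty set, since every point of [O] is the centre of a square inside [O]. *)
Let regular_sq_open O : sq_open O -> regular O.
Proof.
move=> oO e e0.
pose F (n : nat) := [set p : plane R | exists2 q, (~` O) q & sqnear (n.+1%:R^-1 : R) p q].
have oF n : sq_open (F n) by exact: sq_open_sqnear.
have [n|m n mn||n nF] := @nu_vanish (fun n => O `&` F n) e e0.
- by apply: measurableI; exact: sq_open_measurable.
- apply/subsetPset; apply: setIS => p [q Oq [p1 p2]]; exists q => //.
  have H : (n.+1%:R^-1 : R) <= m.+1%:R^-1 by rewrite lef_pV2 ?posrE ?ltr0n// ler_nat.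
  by split; exact: lt_le_trans H.
- rewrite (_ : \bigcap_n _ = set0) ?measure0 ?lte_fin//.
  apply/seteqP; split => // p Fp; have [Op _] := Fp 0%N I.
  have [r r0 rO] := oO _ Op.
  have [_ [q Oq [pq1 pq2]]] := Fp (Num.bound r^-1) I.
  apply: Oq; apply: rO.
  have H : ((Num.bound r^-1).+1%:R^-1 : R) <= r.
    rewrite -[leRHS]invrK lef_pV2 ?posrE ?invr_gt0 ?ltr0n// (le_trans (ltW (archi_boundP _)))//.
      by rewrite invr_ge0 ltW.
    by rewrite ler_nat leqnSn.
  by split; exact: lt_le_trans H.
exists O, (F n); split => // q Oq; exists q => //.
by split; rewrite subrr normr0.
Qed.

Let regularC A : regular A -> regular (~` A).
Proof.
move=> rA e /rA[ O [ O' [oO oO' AO AO' OO']]]; exists O', O.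
by rewrite setCK setIC.
Qed.

(** The union of the [O n] covers the union. Its complement lies in every [O' i], but only finite
    intersections of these are open. The sets [F n] decrease into the union of the overlaps of [O n]
    and [O' n], so a finite stage is already small. *)
Let regular_bigcup (A : (set (plane R))^nat) :
  (forall n, regular (A n)) -> regular (\bigcup_n A n).
Proof.
move=> rA e e0.
(* These errors add up to at most [e / 2], strictly below [e] as [nu_vanish] demands. *)
have e20 (n : nat) : 0 < e / 2 / (2 ^ n.+1)%:R by rewrite !divr_gt0// ltr0n expn_gt0.
have /choice[ O ] := fun n => rA n _ (e20 n).
move=> /choice[ O' OO'].
have oO n : sq_open (O n) by have [] := OO' n.
have oO' n : sq_open (O' n) by have [] := OO' n.
have mO n := sq_open_measurable (oO n).
have mO' n := sq_open_measurable (oO' n).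
pose F n := \bigcup_n O n `&` \big[setI/setT]_(i < n) O' i.
have oF n : sq_open (F n).
  by apply: sq_openI; [exact: sq_open_bigcup|exact: sq_open_bigcapn].
have [n|m n mn||n nF] := @nu_vanish F e e0.
- exact: sq_open_measurable.
- by apply/subsetPset; apply: setIS; exact: subset_bigsetI.
- apply: (@le_lt_trans _ _ (nu (\bigcup_n (O n `&` O' n)))).
    apply: le_measure; rewrite ?inE.
    + by apply: bigcapT_measurable => n; exact: sq_open_measurable.
    + by apply: bigcupT_measurable => n; exact: measurableI.
    move=> p Fp; have [[k _ Okp] _] := Fp 0%N I; exists k => //; split => //.
    by have [_] := Fp k.+1 I; rewrite big_ord_recr/= => -[].
  apply: (@le_lt_trans _ _ (\sum_(n <oo) nu (O n `&` O' n))%E).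
    by apply: measure_sigma_subadditive => // [n|]; [exact: measurableI|
      apply: bigcupT_measurable => n; exact: measurableI].
  apply: (@le_lt_trans _ _ (\sum_(n <oo) (e / 2 / (2 ^ n.+1)%:R)%:E)%E).
    by apply: lee_nneseries => [n _ _|n _]; [exact: measure_ge0|have [] := OO' n].
  apply: le_lt_trans (epsilon_trick0 _ _) _; first by rewrite ltW// divr_gt0.
  by rewrite lte_fin; lra.
exists (\bigcup_n O n), (\big[setI/setT]_(i < n) O' i); split => //.
- exact: sq_open_bigcup.
- exact: sq_open_bigcapn.
- by apply: subset_bigcup => k _; have [] := OO' k.
- move=> p Ap; rewrite -bigcap_mkord => k /= kn.
  by have [_ _ _ + _] := OO' k; apply => Akp; apply: Ap; exists k.
Qed.

(** The sets with this property form a sigma-algebra. It contains the preimages of open intervals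
    under both coordinates, which generate the product sigma-algebra. *)
Let regular_measurable A : measurable A -> regular A.
Proof.
have sigR : sigma_algebra setT regular.
  split => [|B|]; [|by rewrite setTD; exact: regularC|exact: regular_bigcup].
  by apply: regular_sq_open => p.
apply: smallest_sub => //.
have H (f : plane R -> R) : (forall x y, sq_open (f @^-1` `]x, y[)) ->
    preimage_set_system setT f (@measurable _ (measurableTypeR R)) `<=` regular.
  move=> of_ _ [B mB <-]; rewrite setTI.
  have : (@RGenOpens.G R).-sigma.-measurable B by rewrite -RGenOpens.measurableE.
  move: B {mB}.
  suff : (RGenOpens.G (R:=R)).-sigma.-measurable `<=` [set B | regular (f @^-1` B)] by [].
  apply: smallest_sub.
    split => [|B|B] /=; first by rewrite preimage_set0; apply: regular_sq_open => p.
      by rewrite setTD preimage_setC; exact: regularC.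
    by rewrite preimage_bigcup; exact: regular_bigcup.
  by move=> _ [x [y ->]]; exact: regular_sq_open.
rewrite subUset; split; apply: H => x y p /=; rewrite in_itv/= => /andP[xp py].
  exists (Num.min (p.1 - x) (y - p.1)); first by rewrite lt_min !subr_gt0 xp.
  move=> q [+ _]; rewrite in_itv/= lt_min !ltr_norml => /andP[/andP[? ?] /andP[? ?]].
  by apply/andP; split; lra.
exists (Num.min (p.2 - x) (y - p.2)); first by rewrite lt_min !subr_gt0 xp.
move=> q [_]; rewrite in_itv/= lt_min !ltr_norml => /andP[/andP[? ?] /andP[? ?]].
by apply/andP; split; lra.
Qed.

Lemma finite_measure_outer_regular A (e : R) : measurable A -> 0 < e ->
  exists O, [/\ sq_open O, A `<=` O & (nu (O `\` A) <= e%:E)%E].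
Proof.
move=> mA e0; have [ O [ O' [oO oO' AO AO' OO']]] := regular_measurable mA e0.
exists O; split => //; apply: le_trans OO'; apply: le_measure; rewrite ?inE.
- by apply: measurableD => //; exact: sq_open_measurable.
- by apply: measurableI; exact: sq_open_measurable.
- by apply: setIS.
Qed.

End regularity.

(** * Comparison of measures on the plane through dyadic squares *)

Section plane_measure.
Context {R : realType}.
Implicit Types (p q : plane R) (O A : set (plane R)).

Definition box (n : nat) : set (plane R) := [set p | sqnear (n%:R : R) p (0, 0)].

Lemma sq_open_box n : sq_open (box n).
Proof.
have -> : box n = [set p | exists2 q, [set (0, 0)] q & sqnear (n%:R : R) p q].
  by apply/seteqP; split=> [p ?|p [_ -> ?]//]; exists (0, 0).
exact: sq_open_sqnear.
Qed.

Lemma nondecreasing_box : nondecreasing_seq box.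
Proof.
move=> m n mn; apply/subsetPset => p [p1 p2].
have H : (m%:R : R) <= n%:R by rewrite ler_nat.
by split; exact: lt_le_trans H.
Qed.

Lemma bigcup_box : \bigcup_n box n = setT.
Proof.
apply/seteqP; split => // p _; exists (Num.bound (`|p.1| + `|p.2|)) => //.
have H : `|p.1| + `|p.2| < (Num.bound (`|p.1| + `|p.2|))%:R by rewrite archi_boundP.
split; rewrite subr0; apply: le_lt_trans H; rewrite ?lerDl ?lerDr ?normr_ge0//.
Qed.

Lemma nondecreasing_bigcup_le_measure (mu : {measure set (plane R) -> \bar R})
    (F : (set (plane R))^nat) A (c : \bar R) :
  (forall n, measurable (F n)) -> nondecreasing_seq F ->
  (forall n, (mu (A `&` F n) <= c)%E) -> measurable A ->
  (mu (A `&` \bigcup_n F n) <= c)%E.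
Proof.
move=> mF ndF muc mA.
have cA : mu \o (fun n => A `&` F n) @ \oo --> mu (A `&` \bigcup_n F n).
  rewrite setI_bigcupr; apply: nondecreasing_cvg_mu.
  - by move=> n; exact: measurableI.
  - by apply: bigcupT_measurable => n; exact: measurableI.
  - by move=> m n mn; apply/subsetPset; apply: setIS; apply/subsetPset/ndF.
rewrite -(cvg_lim _ cA)//; apply: lime_le; first by apply/cvg_ex; eexists; exact: cA.
exact: nearW.
Qed.

(** Inside a box [nu] is finite, so a measurable set fits in an open set with small excess for [nu],
    and on open sets the comparison is known. The boxes then exhaust the plane. *)
Lemma le_measure_plane (mu nu : {measure set (plane R) -> \bar R}) k0 :
  (forall k i, (k0 <= k)%N -> (mu (pcell k i) <= nu (pcell k i))%E) ->
  (forall n, (nu (box n) < +oo)%E) ->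
  forall A, measurable A -> (mu A <= nu A)%E.
Proof.
move=> munu nufin A mA.
have mbox n := sq_open_measurable (@sq_open_box n).
rewrite -[X in (mu X <= _)%E]setIT -bigcup_box.
apply: nondecreasing_bigcup_le_measure => // [|n]; first exact: nondecreasing_box.
have mAn : measurable (A `&` box n) by exact: measurableI.
apply: (@le_trans _ _ (nu (A `&` box n))); last by apply: le_measure; rewrite ?inE.
apply/lee_addgt0Pr => e e0.
have nunfin : (mrestr nu (mbox n) setT < +oo)%E by rewrite /mrestr setTI.
have [ O [oO AO Oe]] := finite_measure_outer_regular nunfin mAn e0.
have oOb := sq_openI oO (@sq_open_box n).
apply: (@le_trans _ _ (mu (O `&` box n))).
  apply: le_measure; rewrite ?inE//; first exact: sq_open_measurable.
  by move=> p [Ap bp]; split => //; apply: AO.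
apply: (le_trans (sq_open_le_measure munu oOb)).
have mD : measurable ((O `\` (A `&` box n)) `&` box n).
  by apply: measurableI => //; apply: measurableD => //; exact: sq_open_measurable.
apply: (@le_trans _ _ (nu ((A `&` box n) `|` ((O `\` (A `&` box n)) `&` box n)))).
  apply: le_measure; rewrite ?inE; [exact: sq_open_measurable|exact: measurableU|].
  move=> p [Op bp]; have [Ap|nAp] := pselect (A p); first by left.
  by right; split => //; split => // -[].
by apply: le_trans (measureU2 _ mAn mD) _; rewrite leeD2l.
Qed.

Definition lebesgue2 : {measure set (plane R) -> \bar R} :=
  (@lebesgue_measure R \x @lebesgue_measure R)%E.

Lemma lebesgue2_square (a b r : R) : 0 <= r ->
  lebesgue2 [set p : plane R | `|p.1 - a| <= r /\ `|p.2 - b| <= r] = (4 * r ^+ 2)%:E.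
Proof.
move=> r0.
have -> : [set p : plane R | `|p.1 - a| <= r /\ `|p.2 - b| <= r] =
    `[a - r, a + r]%classic `*` `[b - r, b + r]%classic.
  by apply/seteqP; split=> p /=; rewrite !in_itv/= -!ler_distl.
pose I (x : R) : set R := `[x - r, x + r]%classic.
transitivity (@lebesgue_measure R (I a) * @lebesgue_measure R (I b))%E.
  by apply: product_measure1E; exact: measurable_itv.
have H (x : R) : lebesgue_measure (I x) = (2 * r)%:E.
  rewrite lebesgue_measure_itv/= lte_fin.
  case: ltP => xr; first by rewrite -EFinB; congr EFin; lra.
  by congr EFin; lra.
by rewrite !H -EFinM; congr EFin; ring.
Qed.

Lemma measurable_square (a b r : R) :
  measurable [set p : plane R | `|p.1 - a| <= r /\ `|p.2 - b| <= r].
Proof.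
have -> : [set p : plane R | `|p.1 - a| <= r /\ `|p.2 - b| <= r] =
    `[a - r, a + r]%classic `*` `[b - r, b + r]%classic.
  by apply/seteqP; split=> p /=; rewrite !in_itv/= -!ler_distl.
by apply: measurableX; exact: measurable_itv.
Qed.

Lemma lebesgue2_box n : (lebesgue2 (box n) < +oo)%E.
Proof.
apply: (@le_lt_trans _ _
  (lebesgue2 [set p : plane R | (`|p.1 - 0| <= n%:R)%R /\ (`|p.2 - 0| <= n%:R)%R])).
  apply: le_measure; rewrite ?inE.
  - by apply: sq_open_measurable; exact: sq_open_box.
  - exact: measurable_square.
  - by move=> p [p1 p2]; split; exact: ltW.
by rewrite lebesgue2_square// ltry.
Qed.

End plane_measure.

(** * Area distortion of conformal maps *)

Section complex_measurability.
Context {R : realType}.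
Implicit Types (p q : plane R) (z w : Cplx R) (U : set (Cplx R)).

Definition cset U : set (plane R) := [set p | U (p.1 +i* p.2)].

Lemma modulus_sqnear p q (r : R) :
  sqnear r p q -> modulus ((q.1 +i* q.2) - (p.1 +i* p.2) : Cplx R) < r + r.
Proof.
move=> [pq1 pq2]; apply: le_lt_trans (modulus_le_ReIm _ _) _.
by apply: ltrD; rewrite distrC.
Qed.

Lemma sq_open_cset U : open U -> sq_open (cset U).
Proof.
move=> /open_modulusP oU p /oU[d d0 dU]; exists (d / 2); first exact: divr_gt0.
by move=> q /modulus_sqnear; rewrite -splitr => /dU.
Qed.

Lemma measurable_cset U : open U -> measurable (cset U).
Proof. by move=> /sq_open_cset/sq_open_measurable. Qed.

(** Real and imaginary parts are 1-Lipschitz for the modulus, so one argument serves both: preimages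
    of open intervals are open. *)
Lemma measurable_ReIm U (f : Cplx R -> Cplx R) : open U ->
  (forall z, U z -> mcontinuous_at f z) ->
  measurable_fun (cset U) (fun p => complex.Re (f (p.1 +i* p.2))) /\
  measurable_fun (cset U) (fun p => complex.Im (f (p.1 +i* p.2))).
Proof.
move=> oU cf.
have H (l : Cplx R -> R) : (forall z w, `|l z - l w| <= modulus (z - w)) ->
    measurable_fun (cset U) (fun p => l (f (p.1 +i* p.2))).
  move=> lL; apply: (measurability _ (RGenOpens.measurableE R)).
  move=> _ [_ [x [y ->]] <-]; apply: sq_open_measurable => p [Up].
  rewrite /= in_itv/= => /andP[xl ly].
  pose e := Num.min (l (f (p.1 +i* p.2)) - x) (y - l (f (p.1 +i* p.2))).
  have e0 : 0 < e by rewrite lt_min !subr_gt0 xl.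
  have [d d0 dP] := cf _ Up _ e0.
  have [r r0 rU] := sq_open_cset oU Up.
  exists (Num.min r (d / 2)); first by rewrite lt_min r0 divr_gt0.
  move=> q [q1 q2]; have /rU Uq : sqnear r p q.
    by move: q1 q2; rewrite !lt_min => /andP[? _] /andP[? _].
  have /modulus_sqnear : sqnear (d / 2) p q.
    by move: q1 q2; rewrite !lt_min => /andP[_ ?] /andP[_ ?].
  rewrite -splitr => /dP /(le_lt_trans (lL _ _)); rewrite lt_min => /andP[].
  rewrite !ltr_norml => /andP[? ?] /andP[? ?]; split => //=.
  by rewrite in_itv/=; apply/andP; split; lra.
split; apply: H => z w.
  by apply: le_trans (ler_Re_modulus _); rewrite raddfB.
by apply: le_trans (ler_Im_modulus _); rewrite raddfB.
Qed.

End complex_measurability.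

Section derive_measurable.
Context {R : realType}.
Implicit Types (p q : plane R) (z w : Cplx R) (U V : set (Cplx R)).

Lemma ler_dist_modulus z w : `|modulus z - modulus w| <= modulus (z - w).
Proof.
rewrite ler_norml; apply/andP; split.
  by rewrite lerNl opprB lerBlDr modulusBC (le_trans _ (modulusD _ _))// subrK.
by rewrite lerBlDr (le_trans _ (modulusD _ _))// subrK.
Qed.

Lemma modulus_triangle z w y : modulus (z - y) <= modulus (z - w) + modulus (w - y).
Proof. by have := modulusD (z - w) (w - y); rewrite addrA subrK. Qed.

Lemma modulus_real (t : R) : modulus (t%:C : Cplx R) = `|t|.
Proof. by rewrite /modulus normc_def/= expr0n/= addr0 sqrtr_sqr. Qed.

(* The derivative is not known to be continuous here: its modulus is obtained as a
   limit of difference quotients of f extended by 0 outside U. *)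
Lemma measurable_modulus_derive1 U V f : open U -> conformal_map U V f ->
  measurable_fun (cset U) (fun p => modulus (derive1 f (p.1 +i* p.2))).
Proof.
move=> oU Uf; have mU := measurable_cset oU.
have [mRe mIm] := measurable_ReIm oU
  (fun z Uz => has_cderiv_continuous (conformal_has_cderiv Uf Uz)).
pose a := (fun p : plane R => complex.Re (f (p.1 +i* p.2))) \_ (cset U).
pose b := (fun p : plane R => complex.Im (f (p.1 +i* p.2))) \_ (cset U).
have ma : measurable_fun setT a by exact/(measurable_restrictT _ mU).
have mb : measurable_fun setT b by exact/(measurable_restrictT _ mU).
pose s n p : plane R := (p.1 + n.+1%:R^-1, p.2).
have ms n : measurable_fun setT (s n).
  apply: measurable_fun_pair; last exact: measurable_snd.
  by apply: measurable_funD; [exact: measurable_fst|exact: measurable_cst].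
(* With t = 1/(n+1) this is |f(z + t) - f(z)| / t as soon as z + t lies in [U]. Horizontal
   increments suffice because the complex derivative exists. *)
pose h n p : R := n.+1%:R * Num.sqrt ((a (s n p) - a p) ^+ 2 + (b (s n p) - b p) ^+ 2).
have msqrt : measurable_fun setT (@Num.sqrt R).
  apply: continuous_measurable_fun; exact: sqrt_continuous.
apply: (@measurable_fun_cvg _ _ _ _ h).
  move=> n; apply: (measurable_funS measurableT) => //.
  apply: measurable_funM; first exact: measurable_cst.
  apply: (measurableT_comp msqrt).
  apply: measurable_funD; apply: measurable_funX; apply: measurable_funB => //.
    exact: measurableT_comp.
  exact: measurableT_comp.
move=> p Up; have Uz : U (p.1 +i* p.2) by [].
apply/cvgrPdist_le => e e0.
have [d d0 dP] := conformal_has_cderiv Uf Uz e0.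
move/open_modulusP: oU => /(_ _ Uz)[r r0 rU].
have m0 : 0 < Num.min d r by rewrite lt_min d0.
near=> n.
have tm : (n.+1%:R^-1 : R) < Num.min d r.
  by near: n; apply: near_infty_natSinv_lt (PosNum m0).
move: tm; rewrite lt_min => /andP[td tr].
have t0 : 0 < n.+1%:R^-1 :> R by rewrite invr_gt0.
set t : R := n.+1%:R^-1 in td tr t0 *.
set z : Cplx R := p.1 +i* p.2 in Uz dP rU *.
pose w : Cplx R := (p.1 + t) +i* p.2.
have wz : w - z = t%:C.
  by apply/eqP; rewrite eq_complex/=; apply/andP; split; apply/eqP; ring.
have mwz : modulus (w - z) = t by rewrite wz modulus_real gtr0_norm.
have Uw : U w by apply: rU; rewrite mwz.
have Us : s n p \in cset U by rewrite inE.
have -> : h n p = t^-1 * modulus (f w - f z).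
  rewrite /h /a /b /patch Us mem_set// /t invrK; congr (_ * _).
  by rewrite modulusE; case: (f w) => ? ?; case: (f z).
have := dP w; rewrite mwz => /(_ td) H.
have -> : modulus (derive1 f z) - t^-1 * modulus (f w - f z) =
    t^-1 * (modulus (derive1 f z * (w - z)) - modulus (f w - f z)).
  by rewrite modulusM mwz; field; rewrite gt_eqF.
rewrite normrM gtr0_norm ?invr_gt0// mulrC ler_pdivrMr// (le_trans _ H)//.
by rewrite [leRHS]modulusBC; exact: ler_dist_modulus.
Unshelve. all: by end_near. Qed.

End derive_measurable.

(** * Lipschitz pieces and the area of the image *)

Section area_distortion.
Context {R : realType}.
Implicit Types (p q : plane R) (z w : Cplx R) (A : set (plane R)).
Variables (U V : set (Cplx R)) (f : Cplx R -> Cplx R).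
Hypotheses (oU : open U) (oV : open V) (Uf : conformal_map U V f).
(** [phi] is defined on the whole plane so that a measure can be pushed forward along it; on [V] it
    is the inverse of [f]. *)
Variables (phi : plane R -> plane R) (mphi : measurable_fun setT phi).
Hypothesis phi_inverse : forall p, cset V p ->
  (phi p).1 +i* (phi p).2 = inverse_on U f (p.1 +i* p.2).

(** One radius 1/(m+1) serves all points of a piece. The pieces increase with [m] and together
    contain every point of [U] where |f'| < C. *)
Definition lip_set (C : R) (m : nat) : set (plane R) :=
  [set p | cset U p /\ forall w : Cplx R, modulus (w - (p.1 +i* p.2)) < m.+1%:R^-1 ->
    modulus (f w - f (p.1 +i* p.2)) <= C * modulus (w - (p.1 +i* p.2))].

(** A strict violation at z persists near z with the same witness [w], by continuity of [f] at z. So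
    each Lipschitz piece is a difference of two open sets, hence measurable. *)
Let nonlip_open (C : R) m : 0 < C -> sq_open [set p | cset U p /\
  exists2 w : Cplx R, modulus (w - (p.1 +i* p.2)) < m.+1%:R^-1 &
    C * modulus (w - (p.1 +i* p.2)) < modulus (f w - f (p.1 +i* p.2))].
Proof.
move=> C0 p [Up [w wm wC]].
set z : Cplx R := p.1 +i* p.2 in wm wC.
pose gap := modulus (f w - f z) - C * modulus (w - z).
have gap0 : 0 < gap by rewrite subr_gt0.
have [r r0 rU] := sq_open_cset oU Up.
have [d d0 dP] := has_cderiv_continuous (conformal_has_cderiv Uf Up) (divr_gt0 gap0 (ltr0n R 2)).
(* Passing from [z] to a nearby [y] costs less than [gap / 2] on the side of [f] by [d], and less
   than [gap / 2] on the side of [C] by the last term; the middle term keeps [w] within 1/(m+1) of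
   [y]. *)
pose e := Num.min d (Num.min (m.+1%:R^-1 - modulus (w - z)) (gap / 2 / C)).
have e0 : 0 < e by rewrite !lt_min d0 subr_gt0 wm !divr_gt0.
exists (Num.min r (e / 2)); first by rewrite lt_min r0 divr_gt0.
move=> q [q1 q2].
have Uq : cset U q.
  by apply: rU; move: q1 q2; rewrite !lt_min => /andP[? _] /andP[? _].
have /modulus_sqnear : sqnear (e / 2) p q.
  by move: q1 q2; rewrite !lt_min => /andP[_ ?] /andP[_ ?].
rewrite -splitr !lt_min => /and3P[/dP H1 H2 H3].
set y : Cplx R := q.1 +i* q.2 in H1 H2 H3 *.
have H4 : modulus (w - y) <= modulus (w - z) + modulus (y - z).
  by rewrite [modulus (y - z)]modulusBC modulus_triangle.
have H5 := modulus_triangle (f w) (f y) (f z).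
split => //; exists w.
  by apply: le_lt_trans H4 _; rewrite addrC -ltrBrDr.
have H6 : C * modulus (y - z) < gap / 2 by rewrite mulrC -ltr_pdivlMr.
have {}H4 : C * modulus (w - y) <= C * modulus (w - z) + C * modulus (y - z).
  by rewrite -mulrDr; apply: ler_wpM2l H4; exact: ltW.
apply: le_lt_trans H4 _; rewrite -/z /gap in H6 H1 *.
move: (modulus (f y - f z)) H1 H5 => a1 H1 H5.
move: (modulus (f w - f z)) (C * modulus (w - z)) (C * modulus (y - z)) H1 H5 H6.
by move=> *; lra.
Qed.

Let measurable_lip_set (C : R) m : 0 < C -> measurable (lip_set C m).
Proof.
move=> C0; have mN := sq_open_measurable (@nonlip_open C m C0).
have := measurableD (measurable_cset oU) mN.
congr measurable; apply/seteqP; split=> p /=.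
  move=> [Up nN]; split => // w wm; rewrite leNgt; apply/negP => wC.
  by apply: nN; split => //; exists w.
move=> [Up L]; split => // -[_ [w wm]]; rewrite ltNge => /negP; apply.
exact: L.
Qed.

Let nondecreasing_lip_set (C : R) : nondecreasing_seq (lip_set C).
Proof.
move=> m n mn; apply/subsetPset => p [Up L]; split => // w wn; apply: L.
by apply: lt_le_trans wn _; rewrite lef_pV2 ?posrE ?ltr0n// ler_nat.
Qed.

(** The strict inequality leaves C - |f'| > 0 as the error allowed in the differentiability of [f]
    at the point. *)
Let bigcup_lip_set (C : R) p : cset U p ->
  modulus (derive1 f (p.1 +i* p.2)) < C -> (\bigcup_m lip_set C m) p.
Proof.
move=> Up; rewrite -subr_gt0 => pC.
have [d d0 dP] := conformal_has_cderiv Uf Up pC.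
exists (Num.bound d^-1) => //; split => // w wd.
have {}/dP H : modulus (w - (p.1 +i* p.2)) < d.
  apply: lt_le_trans wd _; rewrite -[leRHS]invrK lef_pV2 ?posrE ?invr_gt0 ?ltr0n//.
  rewrite (le_trans (ltW (archi_boundP _)))//; first by rewrite invr_ge0 ltW.
  by rewrite ler_nat leqnSn.
rewrite -[f w - _](subrK (derive1 f (p.1 +i* p.2) * (w - (p.1 +i* p.2)))).
apply: le_trans (modulusD _ _) _; rewrite modulusM.
by rewrite mulrBl in H; lra.
Qed.

Let mV : measurable (cset V) := measurable_cset oV.

(* conformal_area A is the area of f(A), for A included in U. *)
Definition conformal_area : {measure set (plane R) -> \bar R} :=
  measure_function_pushforward__canonical__measure_function_Measure
    (mrestr lebesgue2 mV) mphi.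

(* Two points of a cell are at distance less than 2 * 2^-k, so their images are at
   distance at most r = 2 C 2^-k and the image lies in a square of area
   (2 r)^2 = 16 C^2 4^-k. *)
Let pcell_bound (C : R) (C0 : 0 < C) m k i : (m.+2 <= k)%N ->
  (mrestr conformal_area (measurable_lip_set m C0) (pcell k i) <=
   (16 * C ^+ 2)%:E * lebesgue2 (pcell k i))%E.
Proof.
move=> mk; rewrite [lebesgue2 _]lebesgue_pcell.
rewrite /mrestr /conformal_area /= /pushforward /mrestr.
set B := (X in lebesgue2 X).
have mB : measurable B.
  apply: measurableI => //; rewrite -[X in measurable X]setTI.
  apply: mphi => //; apply: measurableI; first exact: measurable_pcell.
  exact: measurable_lip_set.
have -> : ((16 * C ^+ 2)%:E * ((2 ^- k) ^+ 2)%:E = (4 * (C * (2 ^- k + 2 ^- k)) ^+ 2)%:E)%E.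
  by rewrite -EFinM; congr EFin; ring.
have k0 : 0 < 2 ^- k :> R by rewrite invr_gt0 exprn_gt0.
(* The Lipschitz bound is used from the single point [phi p0], and the square containing the image
   is centred at [p0]. *)
have [->|/set0P[p0 [[p0k [p0U p0L]] p0V]]] := eqVneq B set0.
  by rewrite measure0 lee_fin mulr_ge0// sqr_ge0.
have r0 : 0 <= C * (2 ^- k + 2 ^- k) by rewrite mulr_ge0 ?addr_ge0 ?ltW.
rewrite -(lebesgue2_square p0.1 p0.2 r0); apply: le_measure; rewrite ?inE//.
  exact: measurable_square.
move=> p [[pk _] pV].
have /modulus_sqnear pp0 := pcell_dist p0k pk.
(* Here [m.+2 <= k] enters: twice [2 ^- k] is at most [2 ^- m.+1], hence at most 1/(m+1), so the
   whole cell is within the Lipschitz radius. *)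
have km : (2 ^- k + 2 ^- k : R) <= m.+1%:R^-1.
  have -> : (2 ^- k + 2 ^- k : R) = (2 ^+ k / 2)^-1.
    by rewrite invf_div; field; rewrite expf_neq0.
  rewrite lef_pV2 ?posrE ?divr_gt0 ?exprn_gt0// ler_pdivlMr//.
  rewrite -natrX -natrM ler_nat (leq_trans _ (leq_pexp2l _ mk))// expnS mulnC.
  by rewrite leq_mul2l/= ltnW// ltn_expl.
have /p0L H := lt_le_trans pp0 km.
rewrite !phi_inverse// !(conformal_inverseKV Uf)// in H pp0.
have {}H := le_trans H (ler_wpM2l (ltW C0) (ltW pp0)).
split; apply: le_trans H.
  exact: le_trans (ler_Re_modulus _).
exact: le_trans (ler_Im_modulus _).
Qed.

(** On each Lipschitz piece the bound for squares extends to measurable sets by comparison of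
    measures; letting [m] grow exhausts [A]. *)
Lemma conformal_area_le (C : R) A : 0 < C -> measurable A -> A `<=` cset U ->
  (forall p, A p -> modulus (derive1 f (p.1 +i* p.2)) < C) ->
  (conformal_area A <= (16 * C ^+ 2)%:E * lebesgue2 A)%E.
Proof.
move=> C0 mA AU AC.
have AE : A = A `&` \bigcup_m lip_set C m.
  apply/seteqP; split=> [p Ap|p []//]; split => //; apply: bigcup_lip_set.
    exact: AU.
  exact: AC.
rewrite {1}AE; apply: nondecreasing_bigcup_le_measure => //.
  by move=> m; exact: measurable_lip_set.
move=> m.
have K0 : 0 <= 16 * C ^+ 2 by rewrite mulr_ge0// sqr_ge0.
apply: (@le_measure_plane _ (mrestr conformal_area (measurable_lip_set m C0))
  (mscale (NngNum K0) lebesgue2) m.+2) => //.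
  by move=> k i /pcell_bound; apply.
move=> n; apply: lte_mul_pinfty; rewrite ?lee_fin//.
exact: lebesgue2_box.
Qed.

End area_distortion.

(** * Change of variables up to a constant *)

Section change_of_variables.
Context {R : realType}.
Implicit Types (p q : plane R) (z w : Cplx R) (A : set (plane R)).
Variables (U V : set (Cplx R)) (f : Cplx R -> Cplx R).
Hypotheses (oU : open U) (oV : open V) (Uf : conformal_map U V f).

Let g := inverse_on U f.
Let phi p : plane R :=
  (((fun q : plane R => complex.Re (g (q.1 +i* q.2))) \_ (cset V)) p,
   ((fun q : plane R => complex.Im (g (q.1 +i* q.2))) \_ (cset V)) p).

Let measurable_phi : measurable_fun setT phi.
Proof.
have [mRe mIm] := measurable_ReIm oV
  (fun w => conformal_inverse_continuous oV Uf (w := w)).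
by apply: measurable_fun_pair; apply/(measurable_restrictT _ (measurable_cset oV)).
Qed.

Let phi_inverse p : cset V p ->
  (phi p).1 +i* (phi p).2 = g (p.1 +i* p.2).
Proof. by move=> Vp; rewrite /phi /patch mem_set//=; case: (g _). Qed.

Let J p : R := modulus (derive1 f (p.1 +i* p.2)).

Let mJ : measurable_fun (cset U) J.
Proof. exact: measurable_modulus_derive1 oU Uf. Qed.

Let J_gt0 p : cset U p -> 0 < J p.
Proof. by move=> Up; rewrite /J modulus_gt0; have [/(_ _ Up)[_ ?]] := Uf. Qed.

(* The slice of index [pickle j] is the set where floor (ln |f'|) = j. *)
Let slice (n : nat) : set (plane R) :=
  if pickle_inv n is Some j then
    cset U `&` (fun p => ln (J p)) @^-1` `[(j : int)%:~R, (j + 1)%:~R[%classic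
  else set0.

Let measurable_slice n : measurable (slice n).
Proof.
rewrite /slice; case: pickle_inv => [j|]; last exact: measurable0.
apply: (measurableT_comp (@measurable_ln R) mJ) => //; first exact: measurable_cset.
Qed.

Let trivIset_slice : trivIset setT slice.
Proof.
apply/trivIsetP => m n _ _; rewrite /slice.
have := @pickle_invK int m; have := @pickle_invK int n.
case: pickle_inv => [i|]/=; case: pickle_inv => [j|]/=; rewrite ?set0I ?setI0//.
move=> <- <- ij; apply/seteqP; split => // p [[_ pi] [_ pj]].
have E : i = j.
  move: pi pj; rewrite /= !in_itv/= -!floor_eq => /eqP <- /eqP; exact.
by rewrite E eqxx in ij.
Qed.

Let bigcup_slice : \bigcup_n slice n = cset U.
Proof.
apply/seteqP; split=> [p [n _]|p Up].
  by rewrite /slice; case: pickle_inv => [j [] //|//].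
exists (pickle (Num.floor (ln (J p)))); first exact: Logic.I.
rewrite /slice pickleK_inv.
by split => //=; rewrite in_itv/= -floor_eq.
Qed.

Let integral_slice (mu : {measure set (plane R) -> \bar R}) (F : plane R -> \bar R) :
  measurable_fun (cset U) F -> (forall p, 0 <= F p)%E ->
  (\int[mu]_(p in cset U) F p = \sum_(n <oo) \int[mu]_(p in slice n) F p)%E.
Proof.
move=> mF F0; rewrite -[in LHS]bigcup_slice; apply: ge0_integral_bigcup => //.
by rewrite bigcup_slice.
Qed.

(** On the slice e^j <= |f'| < e^(j+1), the area bound with C = e^(j+1) has factor 16 C^2 <= 16 e^2
    |f'|^2. Summing over the slices gives the constant 16 e^2. *)
Lemma change_of_variables_le (h : Cplx R -> R) :
  (forall w, 0 <= h w) ->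
  measurable_fun (cset V) (fun p => h (p.1 +i* p.2)) ->
  measurable_fun (cset U) (fun p => h (f (p.1 +i* p.2))) ->
  (area_integral V h <= (16 * expR 1 ^+ 2)%:E *
    area_integral U (fun z => (h (f z) * modulus (derive1 f z) ^+ 2)%R))%E.
Proof.
move=> h0 mhV mhU.
have mU := measurable_cset oU; have mV := measurable_cset oV.
pose H p : \bar R := (h (f (p.1 +i* p.2)))%:E.
pose H' := H \_ (cset U).
have H'0 p : (0 <= H' p)%E by rewrite /H' /patch; case: ifP => //; rewrite lee_fin.
have mH : measurable_fun (cset U) H by exact/measurable_EFinP.
have mH' : measurable_fun setT H' by apply/(measurable_restrictT _ mU).
pose nu := conformal_area oV measurable_phi.
pose c : R := 16 * expR 1 ^+ 2.
pose G p : R := h (f (p.1 +i* p.2)) * J p ^+ 2.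
have G0 p : 0 <= G p by rewrite mulr_ge0// sqr_ge0.
have mG : measurable_fun (cset U) G by apply: measurable_funM => //; exact: measurable_funX.
have c0 : 0 <= c by rewrite mulr_ge0// sqr_ge0.
have -> : (area_integral U (fun z => (h (f z) * modulus (derive1 f z) ^+ 2)%R) =
    \int[lebesgue2]_(p in cset U) (G p)%:E)%E by [].
rewrite -ge0_integralZl_EFin//; last 2 first.
- by move=> p _; rewrite lee_fin.
- exact/measurable_EFinP.
have -> : (area_integral V h =
    \int[mrestr lebesgue2 mV]_(p in cset V) (h (p.1 +i* p.2))%:E)%E.
  rewrite /area_integral (@eq_measure_integral _ _ _ _ (mrestr lebesgue2 mV))//.
  by move=> A mA AV; rewrite /= /mrestr setIidl.
have -> : (\int[mrestr lebesgue2 mV]_(p in cset V) (h (p.1 +i* p.2))%:E =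
    \int[mrestr lebesgue2 mV]_(p in cset V) (H' \o phi) p)%E.
  apply: eq_integral => p; rewrite inE => Vp.
  rewrite /= /H' /patch ifT.
    by rewrite /H phi_inverse// (conformal_inverseKV Uf).
  by rewrite inE /cset/= phi_inverse//; exact: conformal_inverse_image Uf _ Vp.
(* The integral over [V] is at most the one over the plane, which is the integral of [H'] for the
   pushforward measure [nu]. *)
apply: (@le_trans _ _ (\int[nu]_p H' p)%E).
  rewrite [leRHS](ge0_integral_pushforward measurable_phi)//.
  rewrite preimage_setT; apply: ge0_subset_integral => //.
    exact: measurableT_comp.
  by move=> p _; exact: H'0.
rewrite -[leLHS]integral_mkcond integral_slice//; last by move=> p; rewrite lee_fin.
rewrite [leRHS]integral_slice; last 2 first.
- by apply: measurable_funeM; exact/measurable_EFinP.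
- by move=> p; rewrite -EFinM lee_fin mulr_ge0.
apply: lee_nneseries => n _; first by move=> _; apply: integral_ge0 => p _; rewrite lee_fin.
have sU : slice n `<=` cset U by rewrite -bigcup_slice; exact: bigcup_sup.
have [j sj] : exists j : int, forall p, slice n p -> j%:~R <= ln (J p) < (j + 1)%:~R.
  rewrite /slice; case: pickle_inv => [j|]; last by exists 0.
  by exists j => p []; rewrite /= in_itv.
have mS := measurable_slice n.
pose C : R := expR (j + 1)%:~R.
have K0 : 0 <= 16 * C ^+ 2 by rewrite mulr_ge0// sqr_ge0.
have -> : (\int[nu]_(p in slice n) H p = \int[mrestr nu mS]_(p in slice n) H' p)%E.
  rewrite (@eq_measure_integral _ _ _ _ (mrestr nu mS)).
    by apply: eq_integral => p; rewrite inE => /sU Up; rewrite /H' /patch mem_set.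
  by move=> A mA AS; rewrite /= /mrestr setIidl.
apply: (@le_trans _ _ (\int[mscale (NngNum K0) lebesgue2]_(p in slice n) H' p)%E).
  apply: ge0_le_measure_integral => // A mA; rewrite /mrestr.
  apply: (@le_trans _ _ ((16 * C ^+ 2)%:E * lebesgue2 (A `&` slice n))%E).
    apply: (conformal_area_le oU oV Uf measurable_phi phi_inverse).
    - exact: expR_gt0.
    - exact: measurableI.
    - by move=> p [_ /sU].
    move=> p [_ sp]; have /andP[_] := sj _ sp.
    by rewrite -ltr_expR lnK// posrE; apply: J_gt0; exact: sU.
  rewrite /mscale /=; apply: lee_wpmul2l; first by rewrite lee_fin.
  by apply: le_measure; rewrite ?inE//; exact: measurableI.
rewrite ge0_integral_mscale//; last exact: measurable_funS mH'.
rewrite -ge0_integralZl_EFin//; last exact: measurable_funS mH'.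
apply: ge0_le_integral => //.
- by move=> p _; rewrite mule_ge0// lee_fin.
- by apply: measurable_funeM; exact: measurable_funS mH'.
- by apply: measurable_funeM; apply/measurable_EFinP; exact: measurable_funS mG.
move=> p sp; rewrite /H' /patch mem_set; last exact: sU.
have /andP[jJ _] := sj _ sp.
have CJ : 16 * C ^+ 2 <= c * J p ^+ 2.
  rewrite -[leRHS]mulrA; apply: ler_wpM2l => //.
  rewrite /C intrD expRD mulrC exprMn; apply: ler_wpM2l; first exact: sqr_ge0.
  rewrite lerXn2r ?nnegrE ?expR_ge0 ?modulus_ge0//.
  by rewrite -[J p]lnK ?ler_expR// posrE; apply: J_gt0; exact: sU.
rewrite /H /= -!EFinM lee_fin /G [leLHS]mulrC [leRHS]mulrCA.
exact: ler_wpM2l.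
Qed.

End change_of_variables.

(** * Finiteness of area integrals *)

Section area_integral.
Context {R : realType}.
Implicit Types (p : plane R) (z w : Cplx R) (U V : set (Cplx R)).

Lemma eq_area_integral U (h k : Cplx R -> R) : {in U, h =1 k} ->
  area_integral U h = area_integral U k.
Proof.
move=> hk; apply: eq_integral => p; rewrite inE => Up.
by rewrite hk// inE.
Qed.

(** One direction is the inequality for [f]. The other is the same inequality for g = f^-1 and k =
    (h o f) |f'|^2, because (k o g) |g'|^2 = h on [V]. *)
Lemma change_of_variables_lty U V f (h : Cplx R -> R) :
  open U -> open V -> conformal_map U V f ->
  (forall w, 0 <= h w) ->
  measurable_fun (cset V) (fun p => h (p.1 +i* p.2)) ->
  measurable_fun (cset U) (fun p => h (f (p.1 +i* p.2))) ->
  (area_integral V h < +oo)%E <->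
  (area_integral U (fun z => (h (f z) * modulus (derive1 f z) ^+ 2)%R) < +oo)%E.
Proof.
move=> oU oV Uf h0 mhV mhU.
have c0 : 0 <= 16 * expR 1 ^+ 2 :> R by rewrite mulr_ge0// sqr_ge0.
split=> [Vh|Uh]; last first.
  apply: le_lt_trans (change_of_variables_le oU oV Uf h0 mhV mhU) _.
  exact: lte_mul_pinfty.
pose g := inverse_on U f.
pose k (z : Cplx R) : R := h (f z) * modulus (derive1 f z) ^+ 2.
have gV : conformal_map V U g := conformal_inverse oU oV Uf.
have kg w : V w -> k (g w) * modulus (derive1 g w) ^+ 2 = h w.
  move=> Vw; rewrite /k (conformal_inverseKV Uf)//.
  rewrite (conformal_inverse_derive1 oV Uf)// modulusV -mulrA -exprMn mulfV ?expr1n ?mulr1//.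
  rewrite modulus_eq0; have [df _ _ _] := Uf.
  by have [] := df _ (conformal_inverse_image Uf Vw).
have k0 z : 0 <= k z by rewrite mulr_ge0// sqr_ge0.
have mkU : measurable_fun (cset U) (fun p => k (p.1 +i* p.2)).
  apply: measurable_funM => //; apply: measurable_funX.
  exact: measurable_modulus_derive1 oU Uf.
have mJg := measurable_modulus_derive1 oV gV.
have mkV : measurable_fun (cset V) (fun p => k (g (p.1 +i* p.2))).
  (* On [V], k o g is h / |g'|^2, whose measurability is known; the quotient is written with the
     real power of exponent -1. *)
  apply: (eq_measurable_fun (fun p => h (p.1 +i* p.2) *
      (modulus (derive1 g (p.1 +i* p.2)) ^+ 2) `^ (-1))).
    move=> p; rewrite inE => Vp; rewrite -(kg _ Vp) powRN powRr1 ?sqr_ge0//.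
    rewrite mulfK// sqrf_eq0 modulus_eq0.
    by have [/(_ _ Vp)[]] := gV.
  apply: measurable_funM => //.
  apply: (measurableT_comp (@measurable_powR R (-1))).
  exact: measurable_funX.
apply: le_lt_trans (change_of_variables_le oV oU gV k0 mkU mkV) _.
apply: lte_mul_pinfty => //.
by rewrite (eq_area_integral (k := h)) // => w; rewrite inE => /kg.
Qed.

Lemma area_integral_max_lty U (a b : Cplx R -> R) : open U ->
  {in U, forall z, 0 <= a z} -> {in U, forall z, 0 <= b z} ->
  measurable_fun (cset U) (fun p => a (p.1 +i* p.2)) ->
  measurable_fun (cset U) (fun p => b (p.1 +i* p.2)) ->
  (area_integral U (fun z => Num.max (a z) (b z)) < +oo)%E <->
  (area_integral U a < +oo)%E /\ (area_integral U b < +oo)%E.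
Proof.
move=> oU a0 b0 ma mb; have mU := measurable_cset oU.
have mmax : measurable_fun (cset U)
  (fun p => Num.max (a (p.1 +i* p.2)) (b (p.1 +i* p.2))) by exact: measurable_maxr.
have {}a0 p : cset U p -> 0 <= a (p.1 +i* p.2) by move=> Up; apply: a0; rewrite inE.
have {}b0 p : cset U p -> 0 <= b (p.1 +i* p.2) by move=> Up; apply: b0; rewrite inE.
split=> [m|[Ua Ub]].
  split; apply: (le_lt_trans _ m); apply: ge0_le_integral => //.
  - exact/measurable_EFinP.
  - exact/measurable_EFinP.
  - by move=> p _; rewrite lee_fin le_max lexx.
  - exact/measurable_EFinP.
  - exact/measurable_EFinP.
  - by move=> p _; rewrite lee_fin le_max lexx orbT.
apply: (@le_lt_trans _ _ (area_integral U a + area_integral U b)%E); last exact: lte_add_pinfty.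
rewrite /area_integral -ge0_integralD//.
- apply: ge0_le_integral => //.
  + by move=> p Up; rewrite lee_fin le_max (a0 _ Up).
  + exact/measurable_EFinP.
  + by apply: emeasurable_funD; exact/measurable_EFinP.
  + move=> p Up; rewrite -EFinD lee_fin ge_max.
    by rewrite lerDl lerDr a0// b0.
- exact/measurable_EFinP.
- exact/measurable_EFinP.
Qed.

Lemma open_unit_disc : open (@unit_disc R).
Proof.
apply/open_modulusP => z; rewrite /unit_disc /= -[1]/(1%:C) ltr_modulus => z1.
exists (1 - modulus z); first by rewrite subr_gt0.
move=> w wz; rewrite ltr_modulus.
rewrite -[w](subrK z) (le_lt_trans (modulusD _ _))//.
by rewrite -ltrBrDr.
Qed.

End area_integral.

(** * Conformal regular pairs *)

Section regular_pair.
Context {R : realType}.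
Variable alpha : R.
Implicit Types (p : plane R) (z w : Cplx R) (U V W : set (Cplx R)).

Lemma powR_div (x y r : R) : 0 <= x -> 0 <= y ->
  (x / y) `^ r = x `^ r * y `^ (- r).
Proof.
move=> x0 y0; rewrite powRM ?invr_ge0//; congr (_ * _).
by rewrite -powR_inv1// -powRrM mulN1r.
Qed.

(** By the chain rule |psi'|^alpha pulls back to |f2'|^alpha |f1'|^(-alpha), and the Jacobian
    contributes |f1'|^2. This serves twice: for [psi], and with the roles of [f1] and [f2] exchanged
    for its inverse. *)
Lemma deriv_in_L_iff U V W (f1 f2 psi : Cplx R -> Cplx R) :
  open U -> open V -> open W -> conformal_map U V f1 -> conformal_map U W f2 ->
  conformal_map V W psi -> {in U, psi \o f1 =1 f2} ->
  deriv_in_L alpha V psi <->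
  (area_integral U (fun z => (modulus (derive1 f2 z) `^ alpha /
     modulus (derive1 f1 z) `^ (alpha - 2))%R) < +oo)%E.
Proof.
move=> oU oV oW Uf1 Uf2 Vpsi psif1.
have d0 V' W' (f : Cplx R -> Cplx R) : conformal_map V' W' f ->
    forall z, V' z -> 0 < modulus (derive1 f z).
  by move=> [df _ _ _] z Vz; rewrite modulus_gt0; have [] := df _ Vz.
have psi'E z : U z ->
    modulus (derive1 psi (f1 z)) = modulus (derive1 f2 z) / modulus (derive1 f1 z).
  move=> Uz; have [_ dE] := eq_conformal_map oU oW (conformal_comp oU oV oW Uf1 Vpsi) psif1.
  rewrite (dE z (mem_set Uz)) (conformal_comp_derive1 Uf1 Vpsi)// modulusM mulfK//.
  by rewrite gt_eqF// (d0 _ _ _ Uf1).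
have hE z : U z -> modulus (derive1 psi (f1 z)) `^ alpha =
    modulus (derive1 f2 z) `^ alpha * modulus (derive1 f1 z) `^ (- alpha).
  move=> Uz; apply: etrans (congr1 (@powR R ^~ alpha) (psi'E z Uz)) _.
  by apply: powR_div; exact: modulus_ge0.
have m1 := measurable_modulus_derive1 oU Uf1.
have m2 := measurable_modulus_derive1 oU Uf2.
rewrite /deriv_in_L (change_of_variables_lty oU oV Uf1)//; first last.
- apply: (eq_measurable_fun (fun p => modulus (derive1 f2 (p.1 +i* p.2)) `^ alpha *
      modulus (derive1 f1 (p.1 +i* p.2)) `^ (- alpha))).
    by move=> p; rewrite inE => Up; exact: esym (hE _ Up).
  apply: measurable_funM.
    exact: (measurableT_comp (@measurable_powR R alpha) m2).
  exact: (measurableT_comp (@measurable_powR R (- alpha)) m1).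
- have mpsi := measurable_modulus_derive1 oV Vpsi.
  exact: (measurableT_comp (@measurable_powR R alpha) mpsi).
- by move=> w; exact: powR_ge0.
rewrite (eq_area_integral (k := fun z => modulus (derive1 f2 z) `^ alpha /
     modulus (derive1 f1 z) `^ (alpha - 2))) //.
move=> z; rewrite inE => Uz; apply: etrans (congr1 (fun x : R => x * _) (hE _ Uz)) _.
rewrite -mulrA; congr (_ * _).
rewrite -powRN -powR_mulrn ?modulus_ge0// -powRD.
  by congr (_ `^ _); ring.
by rewrite (gt_eqF (d0 _ _ _ Uf1 _ Uz)) implybT.
Qed.

(** The values on the disc force psi = phi2 o phi1^-1 on [V], so [psi] is conformal; the two
    integrability conditions are the two quotients under the maximum. *)
Lemma regular_pair_map_iff V W (phi1 phi2 psi : Cplx R -> Cplx R) : 0 < alpha ->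
  open V -> open W -> conformal_map unit_disc V phi1 -> conformal_map unit_disc W phi2 ->
  {in unit_disc, psi \o phi1 =1 phi2} ->
  regular_pair_map alpha V W psi <-> (E_alpha alpha phi1 phi2 < +oo)%E.
Proof.
move=> alpha0 oV oW D1 D2 psi1.
have oD := @open_unit_disc R.
have Vpsi : conformal_map V W psi.
  have V21 := conformal_comp oV oD oW (conformal_inverse oD oV D1) D2.
  have [|+ _] := @eq_conformal_map R V W _ oV oW V21 psi; last by [].
  move=> w; rewrite inE => Vw /=; have Dw := conformal_inverse_image D1 Vw.
  by rewrite -psi1 ?inE//= (conformal_inverseKV D1).
have Wpsi := conformal_inverse oV oW Vpsi.
have L1 := deriv_in_L_iff oD oV oW D1 D2 Vpsi psi1.
have psi2 : {in unit_disc, inverse_on V psi \o phi2 =1 phi1}.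
  move=> z zD; rewrite /= -psi1//=; move: zD; rewrite inE => zD.
  by rewrite (conformal_inverseK Vpsi)//; exact: conformal_image D1 _ zD.
have L2 := deriv_in_L_iff oD oW oV D2 D1 Wpsi psi2.
have m1 := measurable_modulus_derive1 oD D1.
have m2 := measurable_modulus_derive1 oD D2.
have mq (f g : Cplx R -> Cplx R) :
    measurable_fun (cset (@unit_disc R)) (fun p => modulus (derive1 f (p.1 +i* p.2))) ->
    measurable_fun (cset (@unit_disc R)) (fun p => modulus (derive1 g (p.1 +i* p.2))) ->
  measurable_fun (cset (@unit_disc R))
    (fun p => modulus (derive1 f (p.1 +i* p.2)) `^ alpha /
      modulus (derive1 g (p.1 +i* p.2)) `^ (alpha - 2)).
  move=> mf mg; apply: (eq_measurable_fun (fun p => modulus (derive1 f (p.1 +i* p.2)) `^ alpha *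
      modulus (derive1 g (p.1 +i* p.2)) `^ (- (alpha - 2)))).
    by move=> p _; exact: (congr1 (fun x : R => _ * x) (powRN _ _)).
  apply: measurable_funM.
    exact: (measurableT_comp (@measurable_powR R alpha) mf).
  exact: (measurableT_comp (@measurable_powR R (- (alpha - 2))) mg).
have q0 (f g : Cplx R -> Cplx R) z : 0 <= modulus (derive1 f z) `^ alpha /
      modulus (derive1 g z) `^ (alpha - 2) by rewrite divr_ge0// powR_ge0.
have Emax := @area_integral_max_lty R unit_disc
  (fun z => modulus (derive1 phi1 z) `^ alpha / modulus (derive1 phi2 z) `^ (alpha - 2))
  (fun z => modulus (derive1 phi2 z) `^ alpha / modulus (derive1 phi1 z) `^ (alpha - 2))
  oD (fun z _ => q0 phi1 phi2 z) (fun z _ => q0 phi2 phi1 z) (mq _ _ m1 m2) (mq _ _ m2 m1).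
split=> [[_ /L1 ? /L2 ?]|].
  by apply: poweR_lty; apply/Emax; split.
(* The outer root does not affect finiteness, as its exponent [alpha^-1] is nonzero. *)
move=> /lty_poweRy; rewrite invr_eq0 gt_eqF// => /(_ isT)/Emax[I2 I1].
by split; [exact: Vpsi|exact/L1|exact/L2].
Qed.

End regular_pair.

(** Every conformal map of the first domain onto the second is phi2 o eta o phi1^-1 there, for a
    conformal automorphism eta of the disc, and each finiteness condition concerns one such map. The
    first equivalence takes eta = id; the second lets eta vary, as a regular pair asks only for some
    map. *)
Theorem proposition1p3 (R : realType) (alpha : R)
  (phi1 phi2 : Cplx R -> Cplx R)
  (alpha_gt2 : 2 < alpha)
  (phi1_conf : conformal_map unit_disc (phi1 @` unit_disc) phi1)
  (phi2_conf : conformal_map unit_disc (phi2 @` unit_disc) phi2)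
  (Omega1_reg : conformal_regular alpha (phi1 @` unit_disc))
  (Omega2_reg : conformal_regular alpha (phi2 @` unit_disc)) :
  (regular_pair_map alpha (phi1 @` unit_disc) (phi2 @` unit_disc)
     (phi2 \o inverse_on unit_disc phi1)
   <-> (E_alpha alpha phi1 phi2 < +oo)%E)
  /\
  (conformal_regular_pair alpha (phi1 @` unit_disc) (phi2 @` unit_disc)
   <-> exists eta : Cplx R -> Cplx R,
         conformal_map unit_disc unit_disc eta /\
         (E_alpha alpha phi1 (phi2 \o eta) < +oo)%E).
Proof.
have [oO1 _ _] := Omega1_reg; have [oO2 _ _] := Omega2_reg.
have oD := @open_unit_disc R.
have alpha0 : 0 < alpha by exact: lt_trans alpha_gt2.
split.
  apply: regular_pair_map_iff => // z; rewrite inE => Dz /=.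
  by rewrite (conformal_inverseK phi1_conf).
split=> [[_ _ [psi psiP]]|[eta [Deta Eeta]]].
  have [psi_conf _ _] := psiP.
  have psi1 := conformal_comp oD oO1 oO2 phi1_conf psi_conf.
  exists (inverse_on unit_disc phi2 \o (psi \o phi1)).
  have Deta := conformal_comp oD oO2 oD psi1 (conformal_inverse oD oO2 phi2_conf).
  split; first exact: Deta.
  have D2 := conformal_comp oD oD oO2 Deta phi2_conf.
  apply: (proj1 (regular_pair_map_iff alpha0 oO1 oO2 phi1_conf D2 _) psiP).
  move=> z; rewrite inE => Dz /=.
  by rewrite (conformal_inverseKV phi2_conf)//; exact: conformal_image psi1 _ Dz.
split; [exact: Omega1_reg|exact: Omega2_reg|].
exists (phi2 \o eta \o inverse_on unit_disc phi1).
have D2 := conformal_comp oD oD oO2 Deta phi2_conf.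
apply: (proj2 (regular_pair_map_iff alpha0 oO1 oO2 phi1_conf D2 _) Eeta).
by move=> z; rewrite inE => Dz /=; rewrite (conformal_inverseK phi1_conf).
Qed.
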